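(* For every graph $G=(V,E)$ with $n=|V|$ and $m=|E|$, the Gromov hyperbolicity $\delta(G)$ can be computed in time $\mathcal{O}(nd(G)^4+n+m)$.
   Context: $\delta(G)=\max_{u,v,x,y\in V}\frac{S_1-\max\{S_2,S_3\}}{2}$ with $S_1=dist_G(u,v)+dist_G(x,y)$, $S_2=dist_G(u,x)+dist_G(v,y)$, $S_3=dist_G(u,y)+dist_G(v,x)$. Two vertices $u,v$ are twins if $N_G(u)\setminus\{v\}=N_G(v)\setminus\{u\}$; this is an equivalence relation on $V$, and the neighbourhood diversity $nd(G)$ is its number of equivalence classes. *)

(* Defs.v *)
From mathcomp Require Import all_boot all_order all_algebra.

Set Implicit Arguments.
Unset Strict Implicit.
Unset Printing Implicit Defensive.

Import Order.TTheory GRing.Theory Num.Theory.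

Record sgraph (V : finType) := SGraph {
  edge :> rel V;
  edge_sym : symmetric edge;
  edge_irr : irreflexive edge }.

Section Graph.

Variables (V : finType) (G : sgraph V).

Definition edge_set : {set {set V}} :=
  [set A | [exists u, exists v, G u v && (A == [set u; v])]].

Definition nb_edges : nat := #|edge_set|.

Definition neighbours (u : V) : {set V} := [set v | G u v].

Definition twins : rel V :=
  fun u v => neighbours u :\ v == neighbours v :\ u.

Lemma twins_equiv : {in [set: V] & &, equivalence_rel twins}.
Proof.
have sym : forall u v, twins u v = twins v u.
  by move=> u v; rewrite /twins eq_sym.
have twE u v z : twins u v -> z != u -> z != v -> G u z = G v z.
  move=> /eqP/setP/(_ z); rewrite !inE => E zu zv.
  by move: E; rewrite zu zv.
have tr : forall v u w, twins u v -> twins v w -> twins u w.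
  move=> v u w uv vw; have [->//|nuv] := eqVneq u v.
  have [<-//|nvw] := eqVneq v w.
  have [->|nuw] := eqVneq u w; first by rewrite /twins.
  have vu_wu : G v u = G w u by apply: twE.
  have uw_vw : G u w = G v w by apply: twE => //; rewrite eq_sym.
  have uvwv : G u v = G w v.
    by rewrite (edge_sym G u v) vu_wu (edge_sym G w u) uw_vw edge_sym.
  apply/eqP/setP => z; rewrite !inE.
  have [->|nzw] := eqVneq z w; first by rewrite edge_irr andbF.
  have [->|nzu] := eqVneq z u; first by rewrite edge_irr.
  rewrite /=; have [->//|nzv] := eqVneq z v.
  by rewrite (twE u v) // (twE v w).
move=> u v w _ _ _; split; first by rewrite /twins.
move=> uv; apply/idP/idP => h; apply: tr h => //.
by rewrite sym.
Qed.

Definition nd : nat := #|equivalence_partition twins [set: V]|.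

Definition has_walk (u v : V) (k : nat) : bool :=
  [exists p : k.-tuple V, path G u p && (last u p == v)].

Lemma connect_has_walk u v : connect G u v -> exists k, has_walk u v k.
Proof.
move=> /connectP[p Gp vE]; exists (size p).
by apply/existsP; exists (in_tuple p); rewrite Gp vE eqxx.
Qed.

(* The value 0 on disconnected pairs is never used below. *)
Definition dist (u v : V) : nat :=
  match @idP (connect G u v) with
  | ReflectT uv => ex_minn (connect_has_walk uv)
  | ReflectF _ => 0
  end.

Local Open Scope ring_scope.

(* If G is disconnected, only the quadruples with finite distances count,
   that is, those inside one component.  The neutral element 0 is harmless:
   0 is the value at u = v = x = y. *)
Definition hyperbolicity : rat :=
  \big[Num.max/0]_(u : V) \big[Num.max/0]_(v : V)
  \big[Num.max/0]_(x : V)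
  \big[Num.max/0]_(y : V | [&& connect G u v, connect G u x & connect G u y])
    let S1 := (dist u v + dist x y)%N in
    let S2 := (dist u x + dist v y)%N in
    let S3 := (dist u y + dist v x)%N in
    (S1%:R - Num.max S2%:R S3%:R) / 2.

End Graph.

(* Word RAM, in structured form: registers and arrays hold natural numbers, a
   program addresses only the finitely many registers and arrays named in its
   text, and every node of an evaluated expression and every elementary command
   takes one unit of time.  W is the largest number that fits in a word:
   computing a larger one makes the program stuck. *)

Inductive binop := OAdd | OSub | OMul | OLeq.

Inductive expr :=
  | Const of nat
  | Reg of nat
  | Read of nat & expr
  | Bin of binop & expr & expr.

Inductive cmd :=
  | Skip
  | Assign of nat & expr
  | Store of nat & expr & expr
  | Seq of cmd & cmd
  | If of expr & cmd & cmd
  | While of expr & cmd.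

Record state := State {
  regs : nat -> nat;
  arrs : nat -> nat -> nat }.

Definition set_reg (s : state) r x : state :=
  State (fun r' => if r' == r then x else regs s r') (arrs s).

Definition set_arr (s : state) a i x : state :=
  State (regs s)
        (fun a' i' => if (a' == a) && (i' == i) then x else arrs s a' i').

Definition binop_sem (o : binop) (x y : nat) : nat :=
  match o with
  | OAdd => x + y
  | OSub => x - y
  | OMul => x * y
  | OLeq => x <= y
  end.

Definition fits (W x : nat) : option nat := if x <= W then Some x else None.

Fixpoint eval (W : nat) (s : state) (e : expr) : option nat :=
  match e with
  | Const c => fits W c
  | Reg r => Some (regs s r)
  | Read a e1 => omap (arrs s a) (eval W s e1)
  | Bin o e1 e2 =>
      obind (fun x => obind (fun y => fits W (binop_sem o x y)) (eval W s e2))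
            (eval W s e1)
  end.

Fixpoint esize (e : expr) : nat :=
  match e with
  | Const _ | Reg _ => 1
  | Read _ e1 => (esize e1).+1
  | Bin _ e1 e2 => (esize e1 + esize e2).+1
  end.

(* exec W c s s' t: c, started in s, halts in s' after t time units. *)
Inductive exec (W : nat) : cmd -> state -> state -> nat -> Prop :=
  | ExecSkip s : exec W Skip s s 1
  | ExecAssign s r e x : eval W s e = Some x ->
      exec W (Assign r e) s (set_reg s r x) (esize e).+1
  | ExecStore s a e1 e2 i x : eval W s e1 = Some i -> eval W s e2 = Some x ->
      exec W (Store a e1 e2) s (set_arr s a i x) (esize e1 + esize e2).+1
  | ExecSeq s1 s2 s3 c1 c2 t1 t2 :
      exec W c1 s1 s2 t1 -> exec W c2 s2 s3 t2 ->
      exec W (Seq c1 c2) s1 s3 (t1 + t2)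
  | ExecIf s s' e c1 c2 x t : eval W s e = Some x ->
      exec W (if x != 0 then c1 else c2) s s' t ->
      exec W (If e c1 c2) s s' ((esize e).+1 + t)
  | ExecWhileF s e c : eval W s e = Some 0 ->
      exec W (While e c) s s (esize e).+1
  | ExecWhileT s1 s2 s3 e c x t1 t2 : eval W s1 e = Some x -> x != 0 ->
      exec W c s1 s2 t1 -> exec W (While e c) s2 s3 t2 ->
      exec W (While e c) s1 s3 ((esize e).+1 + t1 + t2).

Lemma exec_det W c s s1 s2 t1 t2 :
  exec W c s s1 t1 -> exec W c s s2 t2 -> s1 = s2 /\ t1 = t2.
Proof.
move=> H; elim: H s2 t2 => {c s s1 t1}.
- by move=> s s2 t2 H; inversion H.
- by move=> s r e x ex s2 t2 H; inversion H; subst; split; congruence.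
- by move=> s a e1 e2 i x ei ex s2 t2 H; inversion H; subst; split; congruence.
- move=> s1 s2 s3 c1 c2 t1 t2 _ IH1 _ IH2 s t H.
  inversion H as [| | |? s' ? ? ? ? ? c1s c2s| | |]; subst.
  by have [? ?] := IH1 _ _ c1s; subst; have [-> ->] := IH2 _ _ c2s.
- move=> s s' e c1 c2 x t ex _ IH s2 t2 H.
  inversion H as [| | | |? ? ? ? ? y ? ey cs| |]; subst.
  have xy : y = x by congruence.
  by subst; have [-> ->] := IH _ _ cs.
- move=> s e c e0 s2 t2 H.
  inversion H as [| | | | | |? ? ? ? ? y ? ? ey y0 ? ?]; subst => //.
  have yE : y = 0 by congruence.
  by subst.
- move=> s1 s2 s3 e c x t1 t2 ex x0 _ IH1 _ IH2 s t H.
  inversion H as [| | | | |? ? ? e0|? s' ? ? ? y ? ? ey y0 cs ws]; subst.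
    have xE : x = 0 by congruence.
    by subst.
  by have [? ?] := IH1 _ _ cs; subst; have [-> ->] := IH2 _ _ ws.
Qed.

Definition adjacency_lists (n : nat) (G : sgraph 'I_n)
    (adj : 'I_n -> seq 'I_n) : Prop :=
  forall u, uniq (adj u) /\ forall v, (v \in adj u) = G u v.

(* Register 0 holds n.  Array 1 is the concatenation of the adjacency lists;
   the list of u occupies its cells i with a_u <= i < a_(u+1), where a is
   array 0.  All other registers and cells hold 0. *)
Definition input (n : nat) (adj : 'I_n -> seq 'I_n) : state :=
  let offsets := mkseq (fun i => \sum_(u < n | u < i) size (adj u)) n.+1 in
  let lists := [seq val v | v <- flatten [seq adj u | u <- enum 'I_n]] in
  State (fun r => if r == 0 then n else 0)
        (fun a i => match a with
                    | 0 => nth 0 offsets i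
                    | 1 => nth 0 lists i
                    | _ => 0
                    end).

(* A rational number is output as a fraction, in registers 0 and 1. *)
Definition outputs (s : state) (q : rat) : Prop :=
  regs s 1 <> 0 /\ q = ((regs s 0)%:R / (regs s 1)%:R)%R.

(* Main.v *)
(* Exchanging two twins is an automorphism.  If at least four vertices are kept
   of every twin class with four or more, and all of the smaller classes, such
   exchanges move any quadruple into the set of kept vertices without changing
   its distances; so the maximum may be taken over at most 4 nd(G) vertices.
   They also show that the kept vertices induce an isometric subgraph, whence
   distances can be computed in rounds among the kept vertices, each round
   costing the cube of their number.
   Twin classes are found in linear time by hash-consing: the sorted lists N(u)
   and N[u] are inserted into a trie, for all u simultaneously, and u and v are
   twins if and only if N(u) = N(v) or N[u] = N[v]. *)
Require Import Defs.
From mathcomp Require Import all_boot all_order all_algebra.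
From mathcomp Require Import perm zify.

Set Implicit Arguments.
Unset Strict Implicit.
Unset Printing Implicit Defensive.

(** * Total correctness with time bounds *)

(** The two labellings, by [N(u)] and by [N[u]], never have to be merged. A twin class is a clique
    or an independent set, hence a whole class of one labelling, while every class of either
    labelling lies inside a twin class. Keeping a vertex as long as both of its labels have been
    kept fewer than four times therefore keeps at most four vertices per twin class, and rejects
    only vertices that have four kept twins. Distances are stored shifted by one, with 0 for
    disconnected pairs: memory that initially holds 0 then means [not reached yet], and the shift
    disappears from the difference of two sums of two distances. With [K] kept vertices, shortest
    paths inside the kept set have at most [K] vertices, so [K] rounds of cost [K ^ 3] are enough;
    this matches the [K ^ 4] quadruples of the final maximum. *)

Fixpoint den (s : state) (e : expr) : nat :=
  match e with
  | Const c => c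
  | Reg r => regs s r
  | Read a e1 => arrs s a (den s e1)
  | Bin o e1 e2 => binop_sem o (den s e1) (den s e2)
  end.

(** Overflow is split off from the value: [den] stays total and computes, and the word bound becomes
    an arithmetic side condition. *)
Fixpoint safe (W : nat) (s : state) (e : expr) : Prop :=
  match e with
  | Const c => c <= W
  | Reg r => True
  | Read a e1 => safe W s e1
  | Bin o e1 e2 => [/\ safe W s e1, safe W s e2 &
                       binop_sem o (den s e1) (den s e2) <= W]
  end.

Lemma safe_eval W s e : safe W s e -> eval W s e = Some (den s e).
Proof.
elim: e => [c|r|a e IH|o e1 IH1 e2 IH2] //=; first by rewrite /fits => ->.
  by move=> /IH ->.
by move=> [/IH1-> /IH2->]; rewrite /= /fits => ->.
Qed.

Definition ok (W : nat) (c : cmd) (s : state) (T : nat) (Q : state -> Prop) :=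
  exists s' t, [/\ exec W c s s' t, t <= T & Q s'].

(** Only straight-line code is treated by computation; [While] gets [False] because loops enter
    solely through [Range] and its invariant rule. *)
Fixpoint wp (W : nat) (c : cmd) (s : state) (Q : state -> Prop) : Prop :=
  match c with
  | Skip => Q s
  | Assign r e => safe W s e /\ Q (set_reg s r (den s e))
  | Store a e1 e2 =>
      [/\ safe W s e1, safe W s e2 & Q (set_arr s a (den s e1) (den s e2))]
  | Seq c1 c2 => wp W c1 s (fun s1 => wp W c2 s1 Q)
  | If e c1 c2 =>
      safe W s e /\ if den s e != 0 then wp W c1 s Q else wp W c2 s Q
  | While _ _ => False
  end.

(** Both branches of [If] are charged, which makes the bound independent of the state. *)
Fixpoint cost (c : cmd) : nat :=
  match c with
  | Skip => 1
  | Assign r e => (esize e).+1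
  | Store a e1 e2 => (esize e1 + esize e2).+1
  | Seq c1 c2 => cost c1 + cost c2
  | If e c1 c2 => (esize e).+1 + (cost c1 + cost c2)
  | While _ _ => 0
  end.

Lemma ok_wp W c s Q : wp W c s Q -> ok W c s (cost c) Q.
Proof.
elim: c s Q => [|r e|a e1 e2|c1 IH1 c2 IH2|e c1 IH1 c2 IH2|e c IH] s Q //=.
- by move=> Qs; exists s, 1; split=> //; exact: ExecSkip.
- by move=> [/safe_eval ee Qs]; do 2!eexists; split; [exact: ExecAssign ee|done|done].
- move=> [/safe_eval e1e /safe_eval e2e Qs].
  by do 2!eexists; split; [exact: ExecStore e1e e2e|done|done].
- move=> /IH1[s1 [t1 [ex1 lt1 /IH2[s2 [t2 [ex2 lt2 Qs2]]]]]].
  exists s2, (t1 + t2); split=> //; first exact: ExecSeq ex1 ex2.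
  exact: leq_add.
- move=> [/safe_eval ee].
  case: ifP => e0 => [/IH1|/IH2] [s' [t [ex lt Qs]]];
    (exists s', ((esize e).+1 + t); split=> //; last by lia);
    by apply: (ExecIf ee); rewrite e0.
Qed.

Lemma ok_conseq W c s T T' (Q Q' : state -> Prop) :
  ok W c s T Q -> T <= T' -> (forall s', Q s' -> Q' s') -> ok W c s T' Q'.
Proof.
move=> [s' [t [ex lt Qs]]] TT QQ; exists s', t; split=> //; last exact: QQ.
exact: leq_trans TT.
Qed.

Lemma ok_seq W c1 c2 s T1 T2 Q :
  ok W c1 s T1 (fun s1 => ok W c2 s1 T2 Q) -> ok W (Seq c1 c2) s (T1 + T2) Q.
Proof.
move=> [s1 [t1 [ex1 lt1 [s2 [t2 [ex2 lt2 Qs2]]]]]].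
exists s2, (t1 + t2); split=> //; first exact: ExecSeq ex1 ex2.
exact: leq_add.
Qed.

Fixpoint wregs (c : cmd) : seq nat :=
  match c with
  | Skip | Store _ _ _ => [::]
  | Assign r _ => [:: r]
  | Seq c1 c2 | If _ c1 c2 => wregs c1 ++ wregs c2
  | While _ c => wregs c
  end.

Fixpoint warrs (c : cmd) : seq nat :=
  match c with
  | Skip | Assign _ _ => [::]
  | Store a _ _ => [:: a]
  | Seq c1 c2 | If _ c1 c2 => warrs c1 ++ warrs c2
  | While _ c => warrs c
  end.

(** Invariants mention only what changes; the rest is recovered from the text of the command. *)
Definition frame (c : cmd) (s s' : state) : Prop :=
  (forall r, r \notin wregs c -> regs s' r = regs s r) /\
  (forall a i, a \notin warrs c -> arrs s' a i = arrs s a i).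

Lemma exec_frame W c s s' t : exec W c s s' t -> frame c s s'.
Proof.
elim=> {c s s' t} //=.
- by move=> s r e x _; split=> //= r'; rewrite inE => /negPf->.
- by move=> s a e1 e2 i x _ _; split=> //= a' i'; rewrite inE => /negPf->.
- move=> s1 s2 s3 c1 c2 t1 t2 _ [r1 a1] _ [r2 a2].
  split=> [r|a i]; rewrite mem_cat negb_or => /andP[n1 n2].
    by rewrite r2 // r1.
  by rewrite a2 // a1.
- move=> s s' e c1 c2 x t _ _ [r1 a1].
  by split=> [r|a i]; rewrite mem_cat negb_or => /andP[n1 n2];
    [apply: r1|apply: a1]; case: ifP.
- move=> s1 s2 s3 e c x t1 t2 _ _ _ [r1 a1] _ [r2 a2].
  by split=> [r|a i] n; [rewrite r2 // r1|rewrite a2 // a1].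
Qed.

Lemma ok_frame W c s T Q :
  ok W c s T Q -> ok W c s T (fun s' => Q s' /\ frame c s s').
Proof.
move=> [s' [t [ex lt Qs]]]; exists s', t; split=> //; split=> //.
exact: exec_frame ex.
Qed.

Definition Range (i : nat) (lo : expr) (hi : nat) (body : cmd) : cmd :=
  Seq (Assign i lo)
    (While (Bin OLeq (Bin OAdd (Reg i) (Const 1)) (Reg hi))
       (Seq body (Assign i (Bin OAdd (Reg i) (Const 1))))).

(** An iteration pays 6 for the guard and 4 for the increment; [esize lo + 7] is the initial
    assignment and the failing guard. Strictness in [b < W] lets the guard compute [b + 1]. *)
Lemma ok_range W i lo hi body s a b (J : nat -> state -> Prop) (f : nat -> nat) :
  (hi != i) && (hi \notin wregs body) && (i \notin wregs body) ->
  safe W s lo -> den s lo = a -> regs s hi = b -> a <= b -> b < W ->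
  J a (set_reg s i a) ->
  (forall k s1, a <= k < b -> frame (Range i lo hi body) s s1 ->
     regs s1 i = k -> J k s1 ->
     ok W body s1 (f k) (fun s' => J k.+1 (set_reg s' i k.+1))) ->
  ok W (Range i lo hi body) s
     (\sum_(a <= k < b) (f k + 10) + (esize lo + 7)) (J b).
Proof.
move=> /andP[/andP[hii hib] ib] lo_safe loE hiE ab bW Ja body_ok.
pose w := While (Bin OLeq (Bin OAdd (Reg i) (Const 1)) (Reg hi))
  (Seq body (Assign i (Bin OAdd (Reg i) (Const 1)))).
suff loop : forall d k s1, k + d = b -> a <= k ->
    frame (Range i lo hi body) s s1 -> regs s1 i = k -> J k s1 ->
    ok W w s1 (\sum_(k <= l < b) (f l + 10) + 6) (J b).
  have [|||||s2 [t2 [ex2 lt2 J2]]] := loop (b - a) a (set_reg s i a).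
  - by rewrite subnKC.
  - by [].
  - by split=> //= r; rewrite inE negb_or => /andP[/negPf->].
  - by rewrite /= eqxx.
  - by [].
  exists s2, ((esize lo).+1 + t2); split=> //; last by lia.
  apply: ExecSeq ex2; apply: ExecAssign.
  by rewrite safe_eval ?loE.
elim=> [|d IH] k s1 kd ak fr s1i Jk; have s1hi : regs s1 hi = b.
- by rewrite (proj1 fr) //= inE negb_or hii mem_cat negb_or hib inE.
- have kb : k = b by lia.
  exists s1, 6; split=> //; last by rewrite -kb.
    apply: ExecWhileF; rewrite safe_eval /= s1i s1hi.
      by rewrite (_ : k + 1 <= b = false) //; lia.
    by split=> //; [split=> //; lia|case: leqP => /=; lia].
  by rewrite leq_addl.
- by rewrite (proj1 fr) //= inE negb_or hii mem_cat negb_or hib inE.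
have kb : a <= k < b by lia.
have [s2 [t2 [ex2 lt2 J2]]] := body_ok _ _ kb fr s1i Jk.
have [r2 a2] := exec_frame ex2.
have s2i : regs s2 i = k by rewrite r2.
have [||||s3 [t3 [ex3 lt3 J3]]] :=
  IH k.+1 (set_reg s2 i k.+1) _ _ _ _ J2.
- by lia.
- by lia.
- case: fr => [fr1 fr2]; split=> [r|a' j] /=.
    rewrite inE mem_cat !negb_or => /andP[ri /andP[rb ri']].
    by rewrite (negPf ri) r2 // fr1 //= inE mem_cat !negb_or ri rb.
  by rewrite cats0 => ab'; rewrite a2 // fr2 //= cats0.
- by rewrite /= eqxx.
exists s3, (6 + (t2 + 4) + t3); split=> //; last first.
  by rewrite big_ltn; lia.
apply: (@ExecWhileT _ _ _ _ _ _ 1 _ _ _ _ _ ex3) => //.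
- rewrite safe_eval /= s1i s1hi; first by rewrite (_ : k + 1 <= b) //; lia.
  by split=> //; [split=> //; lia|case: leqP => /=; lia].
- apply: ExecSeq ex2 _; have := @ExecAssign W s2 i (Bin OAdd (Reg i) (Const 1)) k.+1.
  apply; rewrite safe_eval /= s2i ?addn1 //.
  by split=> //; lia.
Qed.

(** The pattern of nested search loops: iteration [k] achieves [P k], all later steps are [R]-steps,
    and [P k] persists along those. *)
Lemma ok_forall W i hi body s K f (I : state -> Prop)
    (R : state -> state -> Prop) (P : nat -> state -> Prop) :
  (hi != i) && (hi \notin wregs body) && (i \notin wregs body) ->
  regs s hi = K -> K < W ->
  (forall s1 s2 s3, R s1 s2 -> R s2 s3 -> R s1 s3) ->
  (forall k s1 s2, R s1 s2 -> P k s1 -> P k s2) ->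
  (forall s1 x, R s1 (set_reg s1 i x)) ->
  (forall s1 x, I s1 -> I (set_reg s1 i x)) ->
  I s ->
  (forall k s1, k < K -> frame (Range i (Const 0) hi body) s s1 ->
     regs s1 i = k -> I s1 ->
     ok W body s1 f (fun s' => [/\ I s', R s1 s' & P k s'])) ->
  ok W (Range i (Const 0) hi body) s (K * (f + 10) + 8)
     (fun s' => [/\ I s', R s s' & forall k, k < K -> P k s']).
Proof.
move=> regs_ok hiE KW Rt Ps Ri Ii Is body_ok.
pose J k s' := [/\ I s', R s s' & forall l, l < k -> P l s'].
have := @ok_range W i (Const 0) hi body s 0 K J (fun=> f) regs_ok.
rewrite sum_nat_const_nat subn0 /=; apply=> //.
  by split=> //; exact: Ii.
move=> k s1 kK fr s1i [Is1 Rs1 Ps1].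
apply: ok_conseq (body_ok _ _ kK fr s1i Is1) _ _ => // s2 [I2 R2 P2].
split; [exact: Ii|exact: Rt (Rt _ _ _ Rs1 R2) (Ri _ _)|].
move=> l; rewrite ltnS leq_eqVlt => /predU1P[->|lk]; first exact: Ps P2.
by apply: (Ps _ _ _ (Ri _ _)); apply: (Ps _ _ _ R2); exact: Ps1.
Qed.

Ltac splits :=
  repeat match goal with
  | |- True => exact I
  | |- and3 _ _ _ => split
  | |- and _ _ => split
  end.

Ltac safety := splits; try lia.

(** * Twin classes *)

Lemma cell_inj n p q y z :
  y < n -> z < n -> (p * n + y == q * n + z) = (p == q) && (y == z).
Proof.
move=> yn zn; apply/eqP/andP => [E|[/eqP-> /eqP->]] //.
have n0 : 0 < n by lia.
have := congr1 (divn^~ n) E; have := congr1 (modn^~ n) E.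
by rewrite !modnMDl !divnMDl // !modn_small // !divn_small // !addn0 => -> ->.
Qed.

Lemma cell_lt n p q z : p < q -> z < n -> p * n + z < q * n.
Proof. by move=> pq zn; nia. Qed.

(* Node [t] spells the word [S t], its child along [z] is in cell [t * n + z]
   of array 3, and [cur x] is the word pushed so far on the target [x].  The
   table has more cells than the time bound allows to clear: it relies on the
   arrays holding 0 initially. *)
Record trie (n : nat) (s : state) (cur S : nat -> seq nat) : Prop := Trie {
  trie_nil : S 0 = [::];
  trie_inj : {in [pred t | t <= regs s 5] &, injective S};
  trie_tail : forall t, 0 < t <= regs s 5 ->
    exists2 p, p <= regs s 5 & exists z, S t = z :: S p;
  trie_le : forall p z, p <= regs s 5 -> z < n ->
    arrs s 3 (p * n + z) <= regs s 5;
  trie_child : forall p z, p <= regs s 5 -> z < n ->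
    arrs s 3 (p * n + z) <> 0 -> S (arrs s 3 (p * n + z)) = z :: S p;
  trie_nochild : forall p z, p <= regs s 5 -> z < n ->
    arrs s 3 (p * n + z) = 0 -> forall t, t <= regs s 5 -> S t <> z :: S p;
  trie_fresh : forall p z, regs s 5 < p -> z < n -> arrs s 3 (p * n + z) = 0;
  trie_lab : forall x, x < n.*2 ->
    arrs s 2 x <= regs s 5 /\ S (arrs s 2 x) = cur x }.

Lemma trie_ext n s s' cur cur' S :
  trie n s cur S -> {in gtn n.*2, cur =1 cur'} ->
  regs s' 5 = regs s 5 -> arrs s' 2 =1 arrs s 2 -> arrs s' 3 =1 arrs s 3 ->
  trie n s' cur' S.
Proof.
move=> [H1 H2 H3 H4 H5 H6 H7 H8] E r5 a2 a3; split; rewrite ?r5 //.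
- by move=> p z *; rewrite a3; exact: H4.
- by move=> p z *; rewrite a3; apply: H5; rewrite -?a3.
- by move=> p z ? ? ?; apply: H6; rewrite -?a3.
- by move=> p z *; rewrite a3; exact: H7.
- by move=> x xn; rewrite a2 -E //; exact: H8.
Qed.

Lemma trie_inj_lab n s cur S x y : trie n s cur S -> x < n.*2 -> y < n.*2 ->
  (arrs s 2 x == arrs s 2 y) = (cur x == cur y).
Proof.
move=> tr xn yn; have [lx cx] := trie_lab tr xn; have [ly cy] := trie_lab tr yn.
by rewrite -cx -cy; apply/eqP/eqP => [->//|/(trie_inj tr)->].
Qed.

(* Use of the registers: 2 current vertex, 3 position in array 1, 4 neighbour,
   5 largest trie node, 6 target of a push, 8 number of kept vertices,
   9 largest gap so far, 10 to 13 indices of kept vertices, 14 round.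
   Use of the arrays: 2 trie node reached by N(u) at index u and by N[u] at
   index n + u, 3 children in the trie, 4 adjacency matrix, 5 and 6 number of
   kept vertices with a given N(u) and N[u], 7 kept vertices, 8 distances. *)
Definition push : cmd :=
  Seq (Assign 7 (Bin OAdd (Bin OMul (Read 2 (Reg 6)) (Reg 0)) (Reg 2)))
  (Seq (If (Read 3 (Reg 7)) Skip
          (Seq (Assign 5 (Bin OAdd (Reg 5) (Const 1))) (Store 3 (Reg 7) (Reg 5))))
       (Store 2 (Reg 6) (Read 3 (Reg 7)))).

Definition extend (z x : nat) (cur : nat -> seq nat) : nat -> seq nat :=
  fun y => if y == x then z :: cur y else cur y.

(** The root is nobody's child, so a cell holding 0 can mark a missing child. A new node gets the
    next number and spells a word that [trie_nochild] shows to be absent, which keeps [S]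
    injective. *)
Lemma push_ok W n s cur S x z :
  regs s 0 = n -> regs s 2 = z -> regs s 6 = x -> z < n -> x < n.*2 ->
  (regs s 5).+1 * n <= W -> regs s 5 < W -> trie n s cur S ->
  ok W push s (cost push)
    (fun s' => (exists S', trie n s' (extend z x cur) S') /\ regs s' 5 <= (regs s 5).+1).
Proof.
move=> r0 r2 r6 zn xn W1 W2 tr; apply: ok_wp.
have [lx cx] := trie_lab tr xn.
rewrite /= r0 r2 r6; set p := arrs s 2 x in lx cx *.
set i := p * n + z.
have iW : i < (regs s 5).+1 * n by apply: cell_lt.
split; first by safety.
split=> //; case: eqVneq => Ti /=.
  split; first by split=> //; lia.
  split=> //; rewrite addn1 !eqxx /= ; split=> //.
  set c := regs s 5 in lx iW W1 W2 *.
  split; last by [].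
  exists (fun t => if t == c.+1 then z :: S p else S t).
  have old t : t <= c -> (t == c.+1) = false by lia.
  have pc := old _ lx.
  have Sp : S p <> z :: S p by move=> /(congr1 size) /=; lia.
  have iE q y : y < n -> (q * n + y == i) = (q == p) && (y == z).
    by move=> yn; rewrite cell_inj.
  split=> /=.
  - by rewrite (trie_nil tr).
  - have no t : t <= c -> S t <> z :: S p by exact: (trie_nochild tr).
    move=> t u; rewrite !inE.
    case: (eqVneq t c.+1) => [->|tc]; case: (eqVneq u c.+1) => [->|uc] //= tc' uc'.
    + by move/esym/no; case; lia.
    + by move/no; case; lia.
    + by apply: (trie_inj tr); rewrite inE -/c; lia.
  - move=> t tc; case: (eqVneq t c.+1) => [_|tc'].
      by exists p; [lia|exists z; rewrite pc].
    have [|q qc [y Sy]] := trie_tail tr (t := t); first by rewrite -/c; lia.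
    by exists q; [rewrite -/c in qc; lia|exists y; rewrite old].
  - move=> q y qc yn; rewrite iE //; case: ifP => //= _.
    have [->|qc'] := eqVneq q c.+1; first by rewrite (trie_fresh tr).
    by have := trie_le tr (p := q) (z := y); rewrite -/c; lia.
  - move=> q y qc yn; rewrite iE //; case: ifP => [/andP[/eqP-> /eqP->] _|_].
      by rewrite eqxx pc.
    have [->|qc'] := eqVneq q c.+1; first by rewrite (trie_fresh tr).
    have qc2 : q <= c by lia.
    by move=> T0; rewrite old ?(trie_le tr) // (trie_child tr).
  - move=> q y qc yn; rewrite iE //; case: ifP => // qp T0 t tc.
    have [qE|qc'] := eqVneq q c.+1.
      case: eqVneq => [_ [_]|tc']; first by move=> /Sp.
      (* The new node must have no child yet. The words of the trie are closed under tails, so an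
         old node spelling [y :: z :: S p] would have a parent spelling [z :: S p], the very word
         that was missing. *)
      move=> St; have t0 : 0 < t by case: (posnP t) St => [->|//]; rewrite (trie_nil tr).
      have [|q' qc2 [y' Sy]] := trie_tail tr (t := t); first by rewrite -/c; lia.
      by move: St; rewrite Sy => -[_]; exact: (trie_nochild tr).
    have qc2 : q <= c by lia.
    case: eqVneq => [_ [zy /(trie_inj tr) pq]|tc'].
      by move: qp; rewrite zy pq ?inE ?eqxx.
    by apply: (trie_nochild tr) => //; rewrite -/c; lia.
  - move=> q y qc yn; rewrite iE //; case: ifP => [|_]; first by lia.
    by apply: (trie_fresh tr) => //; rewrite -/c; lia.
  - move=> y yn; rewrite /extend; case: eqVneq => [->|yx]; rewrite ?eqxx.
      by rewrite cx.
    have [ly cy] := trie_lab tr yn; rewrite old //.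
    by split=> //; rewrite -/c in ly; lia.
split=> //; split; last by [].
exists S.
have [H1 H2 H3 H4 H5 H6 H7 H8] := tr; split=> //= y yn.
rewrite /extend; case: eqVneq => [->|yx] /=; last exact: H8.
by rewrite H4 // H5 ?cx //; exact/eqP.
Qed.

(* Targets below [n] stand for open neighbourhoods, [n + x] stands for the
   closed neighbourhood of [x]. *)
Definition member (nb : nat -> seq nat) (n z x : nat) : bool :=
  if x < n then x \in nb z else (x - n \in nb z) || (x - n == z).

(** Letters are pushed at the head, hence the decreasing order. *)
Definition history nb n v x : seq nat := [seq z <- rev (iota 0 v) | member nb n z x].

(** The words in the middle of the scan of [v]: the targets in [Q] have already received the letter
    [v]. *)
Definition stage nb n v (Q : seq nat) x : seq nat :=
  if x \in Q then v :: history nb n v x else history nb n v x.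

Lemma historyS nb n v Q : (forall x, x < n.*2 -> (x \in Q) = member nb n v x) ->
  {in gtn n.*2, stage nb n v Q =1 history nb n v.+1}.
Proof.
move=> QE x xn; rewrite /stage QE //.
by rewrite /history -[in RHS]addn1 iotaD rev_cat filter_cat /= add0n; case: ifP.
Qed.

Lemma push_stage_ok W nb n s S x v Q :
  regs s 0 = n -> regs s 2 = v -> regs s 6 = x -> v < n -> x < n.*2 ->
  (regs s 5).+1 * n <= W -> regs s 5 < W -> x \notin Q ->
  trie n s (stage nb n v Q) S ->
  ok W push s (cost push)
    (fun s' => (exists S', trie n s' (stage nb n v (x :: Q)) S') /\
               regs s' 5 <= (regs s 5).+1).
Proof.
move=> r0 r2 r6 vn xn W1 W2 xQ tr.
apply: ok_conseq (push_ok r0 r2 r6 vn xn W1 W2 tr) _ _ => // s' [[S' tr'] le5].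
split=> //; exists S'; apply: trie_ext tr' _ _ _ _ => // y yn.
by rewrite /extend /stage inE; case: eqVneq => [->|//]; rewrite (negPf xQ).
Qed.

(** The adjacency lists come in arbitrary order and are not sorted. Instead the scanned vertex [v]
    is the letter, pushed on the words of its neighbours: as [v] increases, every word comes out
    sorted, and by symmetry of the graph the word of [u] collects [N(u)]. *)
Definition scan_arc : cmd :=
  Seq (Seq (Assign 4 (Read 1 (Reg 3)))
      (Seq (Store 4 (Bin OAdd (Bin OMul (Reg 4) (Reg 0)) (Reg 2)) (Const 1))
           (Assign 6 (Reg 4))))
  (Seq push
  (Seq (Assign 6 (Bin OAdd (Reg 0) (Reg 4)))
       push)).

Lemma scan_arc_ok W nb n s S v u Q :
  regs s 0 = n -> regs s 2 = v -> arrs s 1 (regs s 3) = u -> v < n -> u < n ->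
  (regs s 5).+2 * n <= W -> (regs s 5).+2 + n.*2 <= W -> n * n <= W ->
  u \notin Q -> n + u \notin Q ->
  trie n s (stage nb n v Q) S ->
  ok W scan_arc s (cost scan_arc)
    (fun s' => [/\ exists S', trie n s' (stage nb n v [:: n + u, u & Q]) S',
                   regs s' 5 <= (regs s 5).+2 &
                   forall i, arrs s' 4 i =
                     if i == u * n + v then 1 else arrs s 4 i]).
Proof.
move=> r0 r2 a1 vn un W1 W2 W3 uQ nuQ tr.
have uvW : u * n + v < n * n by exact: cell_lt.
apply: ok_seq; apply: ok_wp; rewrite /= a1 r0 r2; safety.
apply: ok_seq; set s1 := set_reg _ 6 u.
have tr1 : trie n s1 (stage nb n v Q) S by apply: trie_ext tr _ _ _ _.
have un2 : u < n.*2 by lia.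
have W4 : (regs s1 5).+1 * n <= W by rewrite /=; nia.
have W5 : regs s1 5 < W by rewrite /=; lia.
apply: ok_conseq (ok_frame (@push_stage_ok W nb n s1 _ _ _ _ r0 r2 erefl vn un2 W4 W5 uQ tr1)) _ _;
  first by [].
move=> s2 [[[S2 tr2] le2] [fr2 fa2]].
apply: ok_seq; apply: ok_wp; rewrite /= !fr2 //= r0; safety.
set s3 := set_reg _ 6 _.
have tr3 : trie n s3 (stage nb n v (u :: Q)) S2 by apply: trie_ext tr2 _ _ _ _.
have nuQ' : n + u \notin u :: Q by rewrite inE negb_or nuQ andbT; lia.
have r30 : regs s3 0 = n by rewrite /= fr2.
have r32 : regs s3 2 = v by rewrite /= fr2.
have r35 : regs s3 5 <= (regs s 5).+1 by [].
have nun2 : n + u < n.*2 by lia.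
have W6 : (regs s3 5).+1 * n <= W by nia.
have W7 : regs s3 5 < W by lia.
apply: ok_conseq (ok_frame (@push_stage_ok W nb n s3 _ _ _ _ r30 r32 erefl vn nun2 W6 W7 nuQ' tr3)) _ _;
  first by [].
move=> s4 [[[S4 tr4] le4] [fr4 fa4]].
split; [by exists S4|by lia|].
by move=> i; rewrite fa4 //= fa2.
Qed.

Definition scan_vertex : cmd :=
  Seq (Assign 15 (Read 0 (Bin OAdd (Reg 2) (Const 1))))
  (Seq (Range 3 (Read 0 (Reg 2)) 15 scan_arc)
  (Seq (Assign 6 (Bin OAdd (Reg 0) (Reg 2)))
       push)).

Definition scan : cmd := Range 2 (Const 0) 0 scan_vertex.

Record neighbour_lists (n : nat) (nb : nat -> seq nat) : Prop := NeighbourLists {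
  nb_uniq : forall v, uniq (nb v);
  nb_lt : forall v x, x \in nb v -> x < n;
  nb_irr : forall v, v \notin nb v }.

Definition arcs (nb : nat -> seq nat) (v : nat) := \sum_(0 <= u < v) size (nb u).

Record graph_input (n : nat) (nb : nat -> seq nat) (s : state) : Prop := GraphInput {
  gi_n : regs s 0 = n;
  gi_off : forall v, v <= n -> arrs s 0 v = arcs nb v;
  gi_adj : forall v i, v < n -> i < size (nb v) ->
    arrs s 1 (arcs nb v + i) = nth 0 (nb v) i }.

Definition targets (n : nat) (P : seq nat) : seq nat := map (addn n) P ++ P.

(** [P] is the part of the list of [v] treated so far. The bound on the number of nodes counts
    pushes: two for each arc, and one for each completed vertex, on its own closed neighbourhood. *)
Definition scanned n nb s v P : Prop :=
  [/\ exists S, trie n s (stage nb n v (targets n P)) S,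
      regs s 5 <= (arcs nb v + size P).*2 + v &
      forall x z, x < n -> z < n ->
        arrs s 4 (x * n + z) =
          ((z < v) && (x \in nb z)) || ((z == v) && (x \in P))].

Lemma scanned_ext n nb s s' v P : scanned n nb s v P ->
  regs s' 5 = regs s 5 -> (forall a i, a \in [:: 2; 3; 4] -> arrs s' a i = arrs s a i) ->
  scanned n nb s' v P.
Proof.
move=> [[S tr] le5 A] r5 E; split; rewrite ?r5 //.
  by exists S; apply: trie_ext tr _ _ _ _ => // i; rewrite E.
by move=> *; rewrite E // A.
Qed.

Lemma mem_targets n P x : {in P, forall y, y < n} ->
  (x \in targets n P) = if x < n then x \in P else x - n \in P.
Proof.
move=> Pn; rewrite mem_cat; case: ltnP => xn.
  by rewrite (_ : x \in map _ _ = false) //; apply/mapP => -[y _]; lia.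
have -> : x \in P = false by apply/negP => /Pn; lia.
rewrite orbF; apply/mapP/idP => [[y yP ->]|xP]; first by rewrite addKn.
by exists (x - n); rewrite ?subnKC.
Qed.

Lemma arcsS nb v : arcs nb v.+1 = arcs nb v + size (nb v).
Proof. by rewrite /arcs big_nat_recr. Qed.

Lemma arcs_le nb u v : u <= v -> arcs nb u <= arcs nb v.
Proof. by move=> uv; rewrite /arcs (big_cat_nat _ uv) //= leq_addr. Qed.

Lemma scan_vertex_ok W n nb s v :
  neighbour_lists n nb -> graph_input n nb s ->
  ((arcs nb n).*2 + n + 4) * n.+2 <= W ->
  v < n -> regs s 2 = v -> scanned n nb s v [::] ->
  ok W scan_vertex s (100 * size (nb v) + 100)
    (fun s' => scanned n nb s' v.+1 [::]).
Proof.
move=> nbP gi bW vn r2 sc; have [r0 off adj] := gi.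
have le1 := arcs_le nb vn; rewrite arcsS in le1.
have nW : n.*2 + 3 < W by nia.
have arcsW : (arcs nb n).*2 + n + 4 <= W by nia.
pose e0 := arcs nb v.
have init : ok W (Assign 15 (Read 0 (Bin OAdd (Reg 2) (Const 1)))) s 5
    (fun s' => s' = set_reg s 15 (arcs nb v.+1)).
  by apply: ok_wp; rewrite /= r2 addn1 off //; safety.
apply: (@ok_conseq W scan_vertex s _ _ (fun s' => scanned n nb s' v.+1 [::]));
  first apply: ok_seq.
- apply: ok_conseq init (leqnn _) _ => s1 ->.
  apply: ok_seq.
  pose J e s' := scanned n nb s' v (take (e - e0) (nb v)).
  have loop := @ok_range W 3 (Read 0 (Reg 2)) 15 scan_arc
    (set_reg s 15 (arcs nb v.+1)) e0 (arcs nb v.+1) J (fun=> cost scan_arc).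
  apply: ok_conseq (ok_frame (loop _ _ _ _ _ _ _ _)) (leqnn _) _ => //.
  + by rewrite /= r2 off // ltnW.
  + by rewrite arcs_le.
  + by rewrite arcsS; lia.
  + by rewrite /J subnn take0; apply: scanned_ext sc _ _.
  + move=> e s2 eb [fr fa] s2e [[S tr] le5 A].
    have s20 : regs s2 0 = n by rewrite fr.
    have s22 : regs s2 2 = v by rewrite fr.
    have ein : e - e0 < size (nb v) by rewrite arcsS in eb; lia.
    set P := take _ _ in tr le5 A; set u := nth 0 (nb v) (e - e0).
    have uin : u \in nb v by exact: mem_nth.
    have un : u < n by exact: (nb_lt nbP uin).
    have PE : take (e.+1 - e0) (nb v) = rcons P u.
      by rewrite subSn; [rewrite (take_nth 0)|lia].
    (* The list has no repetition, so the letter [v] is not pushed twice on the words of [u]. *)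
    have uP : u \notin P.
      have := nb_uniq nbP v; rewrite -(cat_take_drop (e.+1 - e0) (nb v)) PE.
      by rewrite cat_uniq rcons_uniq -andbA => /andP[].
    have Pn : {in P, forall y, y < n}.
      by move=> y /mem_take /(nb_lt nbP).
    have szP : size P = e - e0 by rewrite size_take ein.
    have c5 : (regs s2 5).+2 + n.*2 <= W by rewrite szP in le5; rewrite arcsS in eb; lia.
    have c6 : (regs s2 5).+2 <= (arcs nb n).*2 + n + 4.
      by rewrite szP in le5; rewrite arcsS in eb; lia.
    apply: ok_conseq (@scan_arc_ok W nb n s2 S v u (targets n P)
      s20 s22 _ vn un _ c5 _ _ _ tr) (leqnn _) _.
    * rewrite fa //= s2e -(@subnKC e0 e) ?adj //; by lia.
    * by nia.
    * by nia.
    * by rewrite mem_targets // un.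
    * by rewrite mem_targets // addKn ltnNge leq_addr.
    move=> s3 [[S3 tr3] le3 A3]; rewrite /J PE; split.
    * exists S3; apply: trie_ext tr3 _ _ _ _ => // x xn.
      rewrite /stage (_ : (x \in [:: _, _ & _]) = (x \in targets n (rcons P u))) //.
      rewrite !mem_targets //; last first.
        by move=> y; rewrite mem_rcons inE => /predU1P[->//|/Pn].
      rewrite !inE mem_targets // !mem_rcons !inE; case: ltnP => xn'.
        by rewrite (_ : x == n + u = false) //; apply/eqP; lia.
      rewrite (_ : x == u = false); last by apply/eqP; lia.
      by rewrite orFb; congr (_ || _); apply/eqP/eqP; lia.
    * by rewrite size_rcons /=; lia.
    * move=> x z xn zn; rewrite [LHS]A3 (cell_inj _ _ zn vn) (A _ _ xn zn) mem_rcons inE.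
      have [->|xu] := eqVneq x u; have [->|zv] := eqVneq z v => //=.
        by rewrite orbT.
  move=> s2 [[[S tr] le5 A] [fr fa]].
  have e1E : arcs nb v.+1 - e0 = size (nb v) by rewrite arcsS addKn.
  rewrite e1E take_size in tr le5 A.
  apply: ok_seq; apply: ok_wp; rewrite /= !fr //= r0 r2; safety.
  set s3 := set_reg _ 6 _.
  have s30 : regs s3 0 = n by rewrite /= fr.
  have s32 : regs s3 2 = v by rewrite /= fr.
  have nvn : n + v < n.*2 by lia.
  have W1 : (regs s3 5).+1 * n <= W by rewrite /=; nia.
  have W2 : regs s3 5 < W by rewrite /=; lia.
  (* There are no loops, so the closed neighbourhood of [v] has not received [v] from any arc. *)
  have nin : n + v \notin targets n (nb v).
    rewrite mem_targets; last by move=> y; exact: (nb_lt nbP).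
    by rewrite ltnNge leq_addr addKn (negPf (nb_irr nbP v)).
  have tr3 : trie n s3 (stage nb n v (targets n (nb v))) S.
    by apply: trie_ext tr _ _ _ _.
  apply: ok_conseq (ok_frame (@push_stage_ok W nb n s3 _ _ _ _
    s30 s32 erefl vn nvn W1 W2 nin tr3)) (leqnn _) _.
  move=> s4 [[[S4 tr4] le4] [fr4 fa4]]; split.
  + exists S4; apply: trie_ext tr4 _ _ _ _ => // x xn.
    rewrite [RHS]/stage /= -(@historyS nb n v (n + v :: targets n (nb v))) //.
    move=> y yn; rewrite inE mem_targets; last by move=> ?; exact: (nb_lt nbP).
    rewrite /member; case: ltnP => yn'.
      by rewrite (_ : y == n + v = false) //; apply/eqP; lia.
    by rewrite orbC; congr (_ || _); apply/eqP/eqP; lia.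
  + by rewrite arcsS addn0; rewrite /= in le4; lia.
  + move=> x z xn zn; rewrite fa4 //= A // andbF orbF ltnS [z <= v]leq_eqVlt.
    by case: eqVneq => [->|zv]; rewrite ?ltnn ?orbF.
- rewrite sum_nat_const_nat arcsS addKn.
  by rewrite /cost /=; lia.
- by [].
Qed.

Lemma scan_ok W n nb s :
  neighbour_lists n nb -> graph_input n nb s ->
  ((arcs nb n).*2 + n + 4) * n.+2 <= W ->
  scanned n nb s 0 [::] ->
  ok W scan s (100 * arcs nb n + 110 * n + 8)
    (fun s' => scanned n nb s' n [::]).
Proof.
move=> nbP gi bW sc; have [r0 off adj] := gi.
have nW : n < W by nia.
have loop := @ok_range W 2 (Const 0) 0 scan_vertex s 0 n
   (fun v s' => scanned n nb s' v [::]) (fun v => 100 * size (nb v) + 100).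
apply: ok_conseq (loop _ _ _ _ _ _ _ _) _ _ => //.
- exact: scanned_ext sc _ _.
- move=> v s1 vn [fr fa] s1v sc1.
  apply: ok_conseq (scan_vertex_ok nbP _ bW _ s1v sc1) (leqnn _) _ => //.
    2: by move=> s2 sc2; exact: scanned_ext sc2 _ _.
  by split; rewrite ?fr // => *; rewrite ?fa // ?off // adj.
- under eq_bigr do rewrite -addnA.
  by rewrite big_split sum_nat_const_nat -big_distrr /= subn0 -/(arcs nb n); lia.
Qed.

(* [La] and [Lb] label the open and the closed neighbourhoods.  Four vertices of
   a twin class are enough, since a quadruple meets it in at most four. *)
Record selected (La Lb : nat -> nat) (v : nat) (ks : seq nat) : Prop := Selected {
  sel_uniq : uniq ks;
  sel_lt : {in ks, forall w, w < v};
  sel_a : forall a, count (fun w => La w == a) ks <= 4;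
  sel_b : forall b, count (fun w => Lb w == b) ks <= 4;
  sel_full : forall w, w < v -> w \notin ks ->
    4 <= count (fun w' => La w' == La w) ks \/
    4 <= count (fun w' => Lb w' == Lb w) ks }.

Definition select_vertex : cmd :=
  Seq (Assign 10 (Read 2 (Reg 2)))
  (Seq (Assign 11 (Read 2 (Bin OAdd (Reg 0) (Reg 2))))
  (If (Bin OMul (Bin OLeq (Read 5 (Reg 10)) (Const 3))
                (Bin OLeq (Read 6 (Reg 11)) (Const 3)))
     (Seq (Store 7 (Reg 8) (Reg 2))
     (Seq (Assign 8 (Bin OAdd (Reg 8) (Const 1)))
     (Seq (Store 5 (Reg 10) (Bin OAdd (Read 5 (Reg 10)) (Const 1)))
          (Store 6 (Reg 11) (Bin OAdd (Read 6 (Reg 11)) (Const 1))))))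
     Skip)).

Definition select : cmd := Range 2 (Const 0) 0 select_vertex.

Definition selection La Lb v ks s : Prop :=
  [/\ selected La Lb v ks, regs s 8 = size ks,
      forall i, i < size ks -> arrs s 7 i = nth 0 ks i,
      forall a, arrs s 5 a = count (fun w => La w == a) ks &
      forall b, arrs s 6 b = count (fun w => Lb w == b) ks].

Lemma selected_size La Lb v ks : selected La Lb v ks -> size ks <= v.
Proof.
case=> u lt _ _ _; rewrite -(size_iota 0 v); apply: uniq_leq_size => // w.
by rewrite mem_iota => /lt.
Qed.

Lemma selected_skip La Lb v ks : selected La Lb v ks ->
  4 <= count (fun w' => La w' == La v) ks \/
  4 <= count (fun w' => Lb w' == Lb v) ks -> selected La Lb v.+1 ks.
Proof.
case=> u lt a b full fv; split=> // w; first by move/lt/ltnW.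
by rewrite ltnS leq_eqVlt => /predU1P[->|/full].
Qed.

Lemma selected_keep La Lb v ks : selected La Lb v ks ->
  count (fun w' => La w' == La v) ks <= 3 ->
  count (fun w' => Lb w' == Lb v) ks <= 3 -> selected La Lb v.+1 (rcons ks v).
Proof.
case=> u lt a b full av bv.
have cE (L : nat -> nat) x :
    count (fun w => L w == x) (rcons ks v) = count (fun w => L w == x) ks + (L v == x).
  by rewrite -cats1 count_cat /= addn0.
split.
- by rewrite rcons_uniq u andbT; apply/negP => /lt; rewrite ltnn.
- by move=> w; rewrite mem_rcons inE => /predU1P[->//|/lt/ltnW].
- by move=> x; rewrite cE; case: eqVneq => [<-|_]; rewrite ?addn0 //; lia.
- by move=> x; rewrite cE; case: eqVneq => [<-|_]; rewrite ?addn0 //; lia.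
- move=> w; rewrite ltnS leq_eqVlt mem_rcons inE negb_or.
  move=> wv /andP[wv' wks]; rewrite (negPf wv') /= in wv.
  by rewrite !cE; case: (full w wv wks) => ?; [left|right]; lia.
Qed.

Lemma select_vertex_ok W n La Lb v ks s :
  regs s 0 = n -> regs s 2 = v -> v < n -> n.*2 + 4 <= W ->
  (forall x, x < n -> arrs s 2 x = La x) ->
  (forall x, x < n -> arrs s 2 (n + x) = Lb x) ->
  selection La Lb v ks s ->
  ok W select_vertex s (cost select_vertex)
    (fun s' => exists ks', selection La Lb v.+1 ks' s').
Proof.
move=> r0 r2 vn nW a2 b2 [sel r8 a7 a5 a6].
have szks := selected_size sel.
have ca := sel_a sel (La v); have cb := sel_b sel (Lb v).
apply: ok_wp; rewrite /= r0 r2 a2 // b2 // a5 a6; safety.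
case: (leqP (count (fun w => La w == La v) ks) 3) => la /=; last first.
  by exists ks; split=> //; apply: selected_skip => //; left.
case: (leqP (count (fun w => Lb w == Lb v) ks) 3) => lb /=; last first.
  by exists ks; split=> //; apply: selected_skip => //; right.
rewrite r8; safety; exists (rcons ks v); split.
- exact: selected_keep.
- by rewrite /= size_rcons addn1.
- move=> i; rewrite size_rcons /= nth_rcons => isz.
  case: (ltngtP i (size ks)) => // isz'; first exact: a7.
  by lia.
- move=> a; rewrite /= -cats1 count_cat /= addn0 eq_sym; case: eqP => [<-//|_].
  by rewrite a5 addn0.
- move=> a; rewrite /= -cats1 count_cat /= addn0 eq_sym; case: eqP => [<-//|_].
  by rewrite a6 addn0.
Qed.

Lemma select_ok W n La Lb s :
  regs s 0 = n -> n.*2 + 4 <= W ->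
  (forall x, x < n -> arrs s 2 x = La x) ->
  (forall x, x < n -> arrs s 2 (n + x) = Lb x) ->
  regs s 8 = 0 -> (forall a i, a \in [:: 5; 6] -> arrs s a i = 0) ->
  ok W select s (100 * n + 8) (fun s' => exists ks, selection La Lb n ks s').
Proof.
move=> r0 nW a2 b2 r8 a56.
have loop := @ok_range W 2 (Const 0) 0 select_vertex s 0 n
   (fun v s' => exists ks, selection La Lb v ks s') (fun=> cost select_vertex).
apply: ok_conseq (loop _ _ _ _ _ _ _ _) _ _ => //.
- by lia.
- exists [::]; split=> //= i; rewrite ?a56 //.
- move=> v s1 vn [fr fa] s1v [ks sel].
  apply: ok_conseq (@select_vertex_ok W n La Lb v ks s1 _ s1v _ nW _ _ sel) _ _ => //.
  + by rewrite fr.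
  + by move=> x xn; rewrite fa // a2.
  + by move=> x xn; rewrite fa // b2.
- by rewrite sum_nat_const_nat /=; lia.
Qed.

(** * Distances between the selected vertices *)

(* [xd i j] is the distance between the kept vertices [i] and [j] plus one, or
   0 if they are disconnected. *)
Record levels (K : nat) (adj : rel nat) (xd : nat -> nat -> nat) : Prop := Levels {
  lev_le : forall i j, i < K -> j < K -> xd i j <= K;
  lev_refl : forall i, i < K -> xd i i = 1;
  lev_one : forall i j, i < K -> j < K -> xd i j = 1 -> i = j;
  lev_fwd : forall r i j k, i < K -> j < K -> k < K ->
    xd i k = r.+1 -> adj k j -> 0 < xd i j <= r.+2;
  lev_bwd : forall r i j, i < K -> j < K -> xd i j = r.+2 ->
    exists2 k, k < K & (xd i k = r.+1) /\ adj k j }.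

Definition cell (i j : nat) : expr := Bin OAdd (Bin OMul (Reg i) (Reg 0)) (Reg j).

(* In round [r] a cell is only ever set to [r + 2] on account of cells holding
   [r + 1], so updating the matrix in place is harmless. *)
Definition relax : cmd :=
  If (Bin OMul (Bin OMul (Bin OLeq (Read 8 (cell 10 11)) (Const 0))
                         (Bin OMul (Bin OLeq (Bin OAdd (Reg 14) (Const 1)) (Read 8 (cell 10 12)))
                                   (Bin OLeq (Read 8 (cell 10 12)) (Bin OAdd (Reg 14) (Const 1)))))
               (Read 4 (Bin OAdd (Bin OMul (Read 7 (Reg 12)) (Reg 0)) (Read 7 (Reg 11)))))
     (Store 8 (cell 10 11) (Bin OAdd (Reg 14) (Const 2)))
     Skip.

Definition relax3 : cmd := Range 12 (Const 0) 8 relax.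
Definition relax2 : cmd := Range 11 (Const 0) 8 relax3.
Definition relax1 : cmd := Range 10 (Const 0) 8 relax2.
Definition rounds : cmd := Range 14 (Const 0) 8 relax1.
Definition start : cmd := Range 10 (Const 0) 8 (Store 8 (cell 10 10) (Const 1)).

Definition env n K (adj : rel nat) (s : state) : Prop :=
  [/\ regs s 0 = n, regs s 8 = K, K <= n &
      forall k j, k < K -> j < K ->
        arrs s 7 k < n /\ arrs s 7 j < n /\
        arrs s 4 (arrs s 7 k * n + arrs s 7 j) = adj k j].

Definition partial n K (adj : rel nat) xd r s : Prop :=
  env n K adj s /\ forall i j, i < K -> j < K ->
    (arrs s 8 (i * n + j) <> 0 -> arrs s 8 (i * n + j) = xd i j) /\
    (0 < xd i j <= r.+1 -> arrs s 8 (i * n + j) = xd i j).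

Definition stays8 (s s' : state) : Prop :=
  forall x, arrs s 8 x <> 0 -> arrs s' 8 x <> 0.

Definition reached n (adj : rel nat) (xd : nat -> nat -> nat) r i j k s :=
  xd i k = r.+1 -> adj k j -> arrs s 8 (i * n + j) <> 0.

Lemma relax_ok W n K adj xd r i j k s :
  levels K adj xd -> n * n <= W -> n + 2 <= W ->
  regs s 14 = r -> regs s 10 = i -> regs s 11 = j -> regs s 12 = k ->
  r < K -> i < K -> j < K -> k < K -> partial n K adj xd r s ->
  ok W relax s (cost relax)
    (fun s' => [/\ partial n K adj xd r s', stays8 s s' &
                   reached n adj xd r i j k s']).
Proof.
move=> lev nnW nW r14 r10 r11 r12 rK iK jK kK [en part].
have [r0 r8 Kn cells] := en.
have jn := leq_trans jK Kn; have kn := leq_trans kK Kn; have in' := leq_trans iK Kn.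
have [lk [lj A]] := cells k j kK jK.
have [ij1 ij2] := part i j iK jK; have [ik1 ik2] := part i k iK kK.
have ltij : i * n + j < n * n by exact: cell_lt.
have ltik : i * n + k < n * n by exact: cell_lt.
have ltkj : arrs s 7 k * n + arrs s 7 j < n * n by exact: cell_lt.
have b1 (b : bool) : b <= W by case: b; lia.
apply: ok_wp; rewrite /= r0 r14 r10 r11 r12 A.
split.
  by splits; rewrite ?mulnb ?b1 //; lia.
rewrite !mulnb.
case: ifP => [|fail].
  rewrite eqb0 negbK => /andP[/andP[Dij /andP[rD Dr]] akj].
  have tik : xd i k = r.+1 by rewrite -ik1; lia.
  have tij := lev_fwd lev iK jK kK tik akj.
  (* The cell still holds 0, so the value is not among those up to [r + 1], which are all present;
     [lev_fwd] leaves only [r + 2]. *)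
  have tij' : xd i j = r.+2 by have := ij2; lia.
  safety.
  - split=> // i' j' iK' jK'; rewrite /= cell_inj //; last exact: leq_trans Kn.
    case: ifP => [/andP[/eqP-> /eqP->]|_]; last exact: part.
    by rewrite tij'; split; lia.
  - by move=> x; rewrite /=; case: ifP => // _ _; lia.
  - by move=> _ _; rewrite /= eqxx; lia.
split=> // tik akj Dij; move: fail.
rewrite akj Dij ik2 ?tik //= ?addn1 ?leqnn //.
Qed.

Lemma stays8_trans s1 s2 s3 : stays8 s1 s2 -> stays8 s2 s3 -> stays8 s1 s3.
Proof. by move=> h1 h2 x /h1/h2. Qed.

Lemma reached_stays n adj xd r i j k s s' :
  stays8 s s' -> reached n adj xd r i j k s -> reached n adj xd r i j k s'.
Proof. by move=> h H tik akj; apply/h/H. Qed.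

Definition loop_cost K c := K * (c + 10) + 8.

Lemma round_ok W n K adj xd r s :
  levels K adj xd -> n * n <= W -> n + 2 <= W ->
  regs s 14 = r -> r < K -> partial n K adj xd r s ->
  ok W relax1 s (loop_cost K (loop_cost K (loop_cost K (cost relax))))
    (partial n K adj xd r.+1).
Proof.
move=> lev nnW nW r14 rK ps.
have Kn : K <= n by case: ps => -[].
have KW : K < W by lia.
have r8 s1 : partial n K adj xd r s1 -> regs s1 8 = K by case=> -[].
apply: ok_conseq (@ok_forall W 10 8 relax2 s K _ (partial n K adj xd r) stays8
  (fun i s' => forall j, j < K -> forall k, k < K -> reached n adj xd r i j k s')
  _ _ _ _ _ _ _ _ _) (leqnn _) _ => //.
- exact: r8.
- exact: stays8_trans.
- by move=> i s1 s2 h H j jK k kK; apply: reached_stays h _; exact: H.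
- by move=> s1 x y.
- move=> i s1 iK [fr1 _] s1i ps1.
  apply: (@ok_forall W 11 8 relax3 s1 K _ (partial n K adj xd r) stays8
    (fun j s' => forall k, k < K -> reached n adj xd r i j k s')) => //.
  + exact: r8.
  + exact: stays8_trans.
  + by move=> j s2 s3 h H k kK; apply: reached_stays h _; exact: H.
  + by move=> s2 x y.
  move=> j s2 jK [fr2 _] s2j ps2.
  apply: (@ok_forall W 12 8 relax s2 K _ (partial n K adj xd r) stays8
    (fun k s' => reached n adj xd r i j k s')) => //.
  + exact: r8.
  + exact: stays8_trans.
  + by move=> k s3 s4; exact: reached_stays.
  + by move=> s3 x y.
  move=> k s3 kK [fr3 _] s3k ps3.
  by apply: relax_ok; rewrite // fr3 // fr2 // fr1.
move=> s' [[en part] _ all]; split=> // i j iK jK.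
have [p1 p2] := part i j iK jK; split=> // tij.
have [/eqP tij'|tij'] := eqVneq (xd i j) r.+2; last by apply: p2; lia.
(* Relaxing through the predecessor [k] made the cell nonzero, and nonzero cells are exact. *)
have [k kK [tik akj]] := lev_bwd lev iK jK (eqP tij').
exact/p1/(all i iK j jK k kK tik akj).
Qed.

Lemma rounds_ok W n K adj xd s :
  levels K adj xd -> n * n <= W -> n + 2 <= W -> partial n K adj xd 0 s ->
  ok W rounds s (loop_cost K (loop_cost K (loop_cost K (loop_cost K (cost relax)))))
    (partial n K adj xd K).
Proof.
move=> lev nnW nW ps.
have [[_ r8 Kn _] _] := ps.
have loop := @ok_range W 14 (Const 0) 8 relax1 s 0 K (fun r => partial n K adj xd r)
  (fun=> loop_cost K (loop_cost K (loop_cost K (cost relax)))).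
apply: ok_conseq (loop _ _ _ _ _ _ _ _) _ _ => //.
- by lia.
- move=> r s1 rK _ s1r ps1.
  by apply: ok_conseq (round_ok lev nnW nW s1r _ ps1) (leqnn _) _; first by lia.
- by rewrite sum_nat_const_nat subn0 /loop_cost.
Qed.

Lemma start_ok W n K adj xd s :
  levels K adj xd -> n * n <= W -> n + 2 <= W -> env n K adj s ->
  (forall x, arrs s 8 x = 0) ->
  ok W start s (loop_cost K (cost (Store 8 (cell 10 10) (Const 1))))
    (partial n K adj xd 0).
Proof.
move=> lev nnW nW en D0; have [r0 r8 Kn _] := en.
pose I s' := env n K adj s' /\ forall i j, i < K -> j < K ->
  arrs s' 8 (i * n + j) <> 0 -> arrs s' 8 (i * n + j) = xd i j.
apply: ok_conseq (@ok_forall W 10 8 (Store 8 (cell 10 10) (Const 1)) s K _ I stays8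
  (fun i s' => arrs s' 8 (i * n + i) <> 0)
  _ _ _ _ _ _ _ _ _) (leqnn _) _ => //.
- by lia.
- exact: stays8_trans.
- by move=> i s1 s2 h; exact: h.
- by move=> s1 x y.
- by split.
- move=> i s1 iK _ s1i [en1 Is1]; apply: ok_wp.
  have [r0' _ _ _] := en1; have in' := leq_trans iK Kn.
  have lti : i * n + i < n * n by exact: cell_lt.
  rewrite /= s1i r0'; split; [by safety|by safety|split].
  + split=> // i' j' iK' jK'; rewrite /= cell_inj //; last exact: leq_trans Kn.
    case: ifP => [/andP[/eqP-> /eqP->]|_]; last exact: Is1.
    by rewrite (lev_refl lev).
  + by move=> x; rewrite /=; case: ifP.
  + by rewrite /= eqxx.
move=> s' [[en' Is'] _ diag]; split=> // i j iK jK; split; first exact: Is'.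
move=> tij; have tij1 : xd i j = 1 by lia.
have ij := lev_one lev iK jK tij1; rewrite -ij in jK tij1 *.
by apply: Is' => //; exact: diag.
Qed.

Definition distances : cmd := Seq start rounds.

(** After [K] rounds all positive values up to [K + 1] are present, and [lev_le] allows none above
    [K]. Cells of disconnected pairs have kept their initial 0. *)
Lemma distances_ok W n K adj xd s :
  levels K adj xd -> n * n <= W -> n + 2 <= W -> env n K adj s ->
  (forall x, arrs s 8 x = 0) ->
  ok W distances s
    (loop_cost K 10 + loop_cost K (loop_cost K (loop_cost K (loop_cost K 60))))
    (fun s' => regs s' 0 = n /\ regs s' 8 = K /\
       forall i j, i < K -> j < K -> arrs s' 8 (i * n + j) = xd i j).
Proof.
move=> lev nnW nW en D0.
apply: ok_conseq (ok_seq (ok_conseq (start_ok lev nnW nW en D0) (leqnn _) _)) _ _.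
- by move=> s1 ps1; exact: rounds_ok ps1.
- by rewrite leq_add // /loop_cost !(leq_add2r, leq_mul2l) ?orbT.
move=> s' [[r0 r8 _ _] part]; do 2!split=> //; move=> i j iK jK.
have [p1 p2] := part i j iK jK; have := lev_le lev iK jK.
case: (posnP (xd i j)) => [t0 _|tpos le]; last by apply: p2; lia.
by case: (eqVneq (arrs s' 8 (i * n + j)) 0) => [->|/eqP/p1->].
Qed.

(** * The maximum over all quadruples *)

(* The shift by one of the distances cancels out. *)
Definition gap (xd : nat -> nat -> nat) i j k l :=
  (xd i j + xd k l) - maxn (xd i k + xd j l) (xd i l + xd j k).

Definition linked (xd : nat -> nat -> nat) i j k l :=
  [&& 0 < xd i j, 0 < xd i k & 0 < xd i l].

(** The maximum of [a] and [b] is computed as [a + (b - a)] with truncated subtraction, and products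
    of truth values serve as conjunctions. *)
Definition improve : cmd :=
  Seq (Assign 2 (Read 8 (cell 10 11)))
  (Seq (Assign 3 (Read 8 (cell 10 12)))
  (Seq (Assign 4 (Read 8 (cell 10 13)))
  (Seq (Assign 5 (Bin OAdd (Reg 2) (Read 8 (cell 12 13))))
  (Seq (Assign 6 (Bin OAdd (Reg 3) (Read 8 (cell 11 13))))
  (Seq (Assign 7 (Bin OAdd (Reg 4) (Read 8 (cell 11 12))))
  (Seq (Assign 5 (Bin OSub (Reg 5) (Bin OAdd (Reg 6) (Bin OSub (Reg 7) (Reg 6)))))
  (If (Bin OMul (Bin OLeq (Reg 9) (Reg 5))
        (Bin OMul (Bin OLeq (Const 1) (Reg 2))
          (Bin OMul (Bin OLeq (Const 1) (Reg 3)) (Bin OLeq (Const 1) (Reg 4)))))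
     (Assign 9 (Reg 5)) Skip))))))).

Definition improve4 : cmd := Range 13 (Const 0) 8 improve.
Definition improve3 : cmd := Range 12 (Const 0) 8 improve4.
Definition improve2 : cmd := Range 11 (Const 0) 8 improve3.
Definition maximize : cmd := Range 10 (Const 0) 8 improve2.

Definition best n K xd s : Prop :=
  [/\ regs s 0 = n, regs s 8 = K,
      forall i j, i < K -> j < K -> arrs s 8 (i * n + j) = xd i j &
      regs s 9 = 0 \/ exists i j k l, [/\ [/\ i < K, j < K, k < K & l < K],
        linked xd i j k l & regs s 9 = gap xd i j k l]].

Definition grows9 (s s' : state) : Prop := regs s 9 <= regs s' 9.

Definition beaten xd i j k l s : Prop := linked xd i j k l -> gap xd i j k l <= regs s 9.

Lemma improve_ok W n K xd i j k l s :
  (forall i j, i < K -> j < K -> xd i j <= K) ->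
  n * n <= W -> n * 4 + 2 <= W -> K <= n ->
  regs s 10 = i -> regs s 11 = j -> regs s 12 = k -> regs s 13 = l ->
  i < K -> j < K -> k < K -> l < K -> best n K xd s ->
  ok W improve s (cost improve)
    (fun s' => [/\ best n K xd s', grows9 s s' & beaten xd i j k l s']).
Proof.
move=> tgK nnW nW Kn r10 r11 r12 r13 iK jK kK lK [r0 r8 D b].
have idx p q : p < K -> q < K -> (p * n <= W) && (p * n + q <= W).
  move=> pK qK; have := @cell_lt n p n q (leq_trans pK Kn) (leq_trans qK Kn).
  by lia.
have b1 (c : bool) : c <= W by case: c; lia.
have bt i' j' : i' < K -> j' < K -> xd i' j' <= n by move=> *; rewrite (leq_trans (tgK _ _ _ _)).
have [tij tik til tkl] : [/\ xd i j <= n, xd i k <= n, xd i l <= n & xd k l <= n].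
  by split; exact: bt.
have [tjl tjk] : xd j l <= n /\ xd j k <= n by split; exact: bt.
have [[/andP[? ?] /andP[? ?]] /andP[? ?]] :=
  (idx i j iK jK, idx i k iK kK, idx i l iK lK).
have [[/andP[? ?] /andP[? ?]] /andP[? ?]] :=
  (idx k l kK lK, idx j l jK lK, idx j k jK kK).
apply: ok_wp; rewrite /= r0 r10 r11 r12 r13 !D // !mulnb.
rewrite -maxnE -/(gap xd i j k l).
splits; rewrite ?b1 //; try by rewrite /gap; lia.
case: ifP => [|fail].
  rewrite eqb0 negbK => /andP[le9 lk]; split=> //.
  split.
  - by split=> //; right; exists i, j, k, l.
  - by rewrite /grows9 /=.
  - by move=> _ /=.
split=> //; first by rewrite /grows9 /=.
rewrite /beaten => lk; move: fail; rewrite eqb0 negbK.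
move: lk; rewrite /linked => /and3P[-> -> ->]; rewrite !andbT.
by move/negbT; rewrite -ltnNge => /ltnW.
Qed.

Lemma beaten_grows xd i j k l s s' :
  grows9 s s' -> beaten xd i j k l s -> beaten xd i j k l s'.
Proof. by move=> h b lk; exact: leq_trans (b lk) h. Qed.

Lemma grows9_trans s1 s2 s3 : grows9 s1 s2 -> grows9 s2 s3 -> grows9 s1 s3.
Proof. exact: leq_trans. Qed.

Lemma maximize_ok W n K xd s :
  (forall i j, i < K -> j < K -> xd i j <= K) ->
  n * n <= W -> n * 4 + 2 <= W -> K <= n -> best n K xd s ->
  ok W maximize s (loop_cost K (loop_cost K (loop_cost K (loop_cost K (cost improve)))))
    (fun s' => best n K xd s' /\
       forall i j k l, i < K -> j < K -> k < K -> l < K -> beaten xd i j k l s').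
Proof.
move=> tgK nnW nW Kn bs.
have KW : K < W by lia.
have r8 s1 : best n K xd s1 -> regs s1 8 = K by case.
apply: ok_conseq (@ok_forall W 10 8 improve2 s K _ (best n K xd) grows9
  (fun i s' => forall j, j < K -> forall k, k < K -> forall l, l < K ->
     beaten xd i j k l s')
  _ _ _ _ _ _ _ _ _) (leqnn _) _ => //.
- exact: r8.
- exact: grows9_trans.
- by move=> i s1 s2 h H j jK k kK l lK; apply: beaten_grows h _; exact: H.
- by move=> s1 x; exact: leqnn.
- move=> i s1 iK [fr1 _] s1i bs1.
  apply: (@ok_forall W 11 8 improve3 s1 K _ (best n K xd) grows9
    (fun j s' => forall k, k < K -> forall l, l < K -> beaten xd i j k l s')) => //.
  + exact: r8.
  + exact: grows9_trans.
  + by move=> j s2 s3 h H k kK l lK; apply: beaten_grows h _; exact: H.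
  + by move=> s2 x; exact: leqnn.
  move=> j s2 jK [fr2 _] s2j bs2.
  apply: (@ok_forall W 12 8 improve4 s2 K _ (best n K xd) grows9
    (fun k s' => forall l, l < K -> beaten xd i j k l s')) => //.
  + exact: r8.
  + exact: grows9_trans.
  + by move=> k s3 s4 h H l lK; apply: beaten_grows h _; exact: H.
  + by move=> s3 x; exact: leqnn.
  move=> k s3 kK [fr3 _] s3k bs3.
  apply: (@ok_forall W 13 8 improve s3 K _ (best n K xd) grows9
    (fun l s' => beaten xd i j k l s')) => //.
  + exact: r8.
  + exact: grows9_trans.
  + by move=> l s4 s5; exact: beaten_grows.
  + by move=> s4 x; exact: leqnn.
  move=> l s4 lK [fr4 _] s4l bs4.
  apply: improve_ok bs4 => //; first by rewrite fr4 // fr3 // fr2.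
    by rewrite fr4 // fr3.
  by rewrite fr4.
move=> s' [bs' _ all]; split=> // i j k l iK jK kK lK.
exact: all.
Qed.

(** * Twins and distances *)

Lemma count_lt (T : eqType) (a b : pred T) (s : seq T) (x : T) :
  {in s, subpred a b} -> x \in s -> b x -> ~~ a x -> count a s < count b s.
Proof.
move=> sub xs bx ax; rewrite -size_filter -(size_filter b).
rewrite -(count_predC a [seq y <- s | b y]) count_filter.
rewrite size_filter (@eq_in_count _ a (predI a b)); last first.
  by move=> y ys /=; case ay : (a y); rewrite /= ?(sub y ys ay).
by rewrite -[X in X < _]addn0 ltn_add2l -has_count; apply/hasP; exists x => //=;
  rewrite mem_filter bx.
Qed.

Section Graph.

Variables (V : finType) (G : sgraph V).

Lemma has_walkP u v k :
  reflect (exists p, [/\ size p = k, path G u p & last u p = v]) (has_walk G u v k).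
Proof.
apply: (iffP existsP) => [[p /andP[Gp /eqP pv]]|[p [<- Gp pv]]].
  by exists p; rewrite size_tuple.
by exists (in_tuple p); rewrite Gp pv eqxx.
Qed.

Lemma has_walk_connect u v k : has_walk G u v k -> connect G u v.
Proof. by move=> /has_walkP[p [_ Gp <-]]; apply/connectP; exists p. Qed.

Lemma distP u v : connect G u v ->
  has_walk G u v (dist G u v) /\ forall k, has_walk G u v k -> dist G u v <= k.
Proof.
rewrite /dist => uv0.
(* [dist] matches on [idP] and uses the proof found there, so the match is generalised by hand, with
   the whole statement as motive. *)
refine (match @idP (connect G u v) as r return
  let d := match r with ReflectT uv => ex_minn (connect_has_walk uv)
                      | ReflectF _ => 0 end in
  has_walk G u v d /\ forall k, has_walk G u v k -> d <= k
  with ReflectT uv => _ | ReflectF nuv => _ end) => /=; last by [].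
by case: ex_minnP.
Qed.

(* The same shifted distance as in [levels]. *)
Definition xdist u v := if connect G u v then (dist G u v).+1 else 0.

Lemma xdist_gt0 u v : (0 < xdist u v) = connect G u v.
Proof. by rewrite /xdist; case: ifP. Qed.

Lemma xdist_le u v k : has_walk G u v k -> 0 < xdist u v <= k.+1.
Proof.
by move=> w; have uv := has_walk_connect w; rewrite /xdist uv /= ltnS (distP uv).2.
Qed.

Lemma xdist_walk u v k : xdist u v = k.+1 -> has_walk G u v k.
Proof. by rewrite /xdist; case: ifP => // uv [<-]; exact: (distP uv).1. Qed.

Lemma xdist_refl u : xdist u u = 1.
Proof.
have /xdist_le : has_walk G u u 0 by apply/has_walkP; exists [::].
by lia.
Qed.

Lemma xdist_one u v : xdist u v = 1 -> u = v.
Proof. by move=> /xdist_walk/has_walkP[p [/size0nil-> _ <-]]. Qed.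

Lemma xdist_fwd r u v z : xdist u z = r.+1 -> G z v -> 0 < xdist u v <= r.+2.
Proof.
move=> /xdist_walk/has_walkP[p [sp Gp pz]] zv; apply: xdist_le; apply/has_walkP.
by exists (rcons p v); rewrite size_rcons sp rcons_path Gp pz zv last_rcons.
Qed.

Lemma xdist_bwd r u v : xdist u v = r.+2 -> exists2 z, xdist u z = r.+1 & G z v.
Proof.
move=> uv; have /has_walkP[p [sp Gp pv]] := xdist_walk uv.
case/lastP: p sp Gp pv => // p z; rewrite size_rcons rcons_path last_rcons.
move=> [sp] /andP[Gp Gz] zv; rewrite zv in Gz; exists (last u p) => //.
have /xdist_le uz : has_walk G u (last u p) r by apply/has_walkP; exists p.
(* If the predecessor were closer to [u] than along this walk, [v] would be closer too. *)
case E : (xdist u (last u p)) uz => [//|k] kr.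
by have := xdist_fwd E Gz; rewrite uv; lia.
Qed.

Lemma xdist_hom (h : V -> V) u v : (forall x y, G x y -> G (h x) (h y)) ->
  0 < xdist u v -> 0 < xdist (h u) (h v) <= xdist u v.
Proof.
move=> hom; case E : (xdist u v) => [//|k] _; apply: xdist_le.
have /has_walkP[p [sp Gp pv]] := xdist_walk E; apply/has_walkP.
exists (map h p); rewrite size_map last_map pv; split=> //.
by elim: p u Gp {sp pv E} => //= x p IH u /andP[/hom-> /IH].
Qed.

Lemma twinsE u v z : twins G u v -> z != u -> z != v -> G u z = G v z.
Proof. by move=> /eqP/setP/(_ z); rewrite !inE => E zu zv; move: E; rewrite zu zv. Qed.

Lemma swap_hom u v x y : twins G u v -> G x y -> G (tperm u v x) (tperm u v y).
Proof.
move=> uv; have irr z : G z z = false by exact: edge_irr.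
case: tpermP => [->|->|/eqP xu /eqP xv]; case: tpermP => [->|->|/eqP yu /eqP yv] //;
  rewrite ?irr //; do ?[by rewrite edge_sym].
- by rewrite -(twinsE uv).
- by rewrite (twinsE uv).
- by rewrite !(edge_sym G x) -(twinsE uv).
- by rewrite !(edge_sym G x) (twinsE uv).
Qed.

(** A homomorphism does not increase [xdist] and preserves connectedness; the transposition is its
    own inverse, which gives the other direction. *)
Lemma xdist_swap u v x y : twins G u v -> xdist (tperm u v x) (tperm u v y) = xdist x y.
Proof.
move=> uv; have hom a b := @swap_hom u v a b uv.
have h1 := @xdist_hom _ x y hom; have := @xdist_hom _ (tperm u v x) (tperm u v y) hom.
rewrite !tpermK; lia.
Qed.

(* Every twin class is a clique or an independent set. *)
Lemma twins_uniform c :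
  (forall w, twins G c w -> forall z, G w z = G c z) \/
  (forall w, twins G c w -> forall z, G w z || (z == w) = G c z || (z == c)).
Proof.
case: (boolP [exists w, twins G c w && G c w]) => [/existsP[w0 /andP[t0 e0]]|].
  right=> w tw z; have [->|wc] := eqVneq w c; first by [].
  have irr x : G x x = false by exact: edge_irr.
  (* One adjacent twin forces all: [w0] sees [c], hence also the twin [w] of [c], and [c] shares
     this neighbour with its twin [w0]. *)
  have cw : G c w.
    have [<-//|w0w] := eqVneq w0 w.
    have w0c : w0 != c by apply/eqP => E; rewrite E irr in e0.
    have w0w' : G w0 w by rewrite edge_sym -(twinsE tw).
    by rewrite (twinsE t0) // eq_sym.
  have [->|zw] := eqVneq z w; first by rewrite cw orbT.
  have [->|zc] := eqVneq z c; first by rewrite edge_sym cw orbT.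
  by rewrite (twinsE tw).
rewrite negb_exists => /forallP no; left=> w tw z.
have cw : G c w = false by have := no w; rewrite tw => /negPf.
have [->|zw] := eqVneq z w; first by rewrite cw edge_irr.
have [->|zc] := eqVneq z c; first by rewrite edge_sym cw edge_irr.
by rewrite (twinsE tw).
Qed.

Lemma twins_open u v : (forall z, G u z = G v z) -> twins G u v.
Proof.
move=> E; apply/eqP/setP => z; rewrite !inE E.
have [->|zv] := eqVneq z v; first by rewrite edge_irr !andbF.
by have [->|//] := eqVneq z u; rewrite -E edge_irr.
Qed.

Lemma twins_closed u v :
  (forall z, G u z || (z == u) = G v z || (z == v)) -> twins G u v.
Proof.
move=> E; apply/eqP/setP => z; rewrite !inE; have := E z.
have [->|zv] := eqVneq z v; first by have [->|//] := eqVneq v u; rewrite edge_irr andbF.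
have [->|zu] := eqVneq z u; rewrite ?orbF //=; first by rewrite edge_irr.
Qed.

(** * Shortest paths and quadruples inside the kept set *)

Section Kept.

Variable H : {set V}.
Hypothesis full : forall z, z \notin H -> 4 <= #|[set w in H | twins G z w]|.

(** Three forbidden vertices cannot exhaust four kept twins. *)
Lemma fresh_twin z (s : seq V) : z \notin H -> size s <= 3 ->
  exists z', [/\ z' \in H, twins G z z' & z' \notin s].
Proof.
move=> zH ss.
case: (pickP [pred w | [&& w \in H, twins G z w & w \notin s]]) => [w /and3P[]|no].
  by exists w.
have : [set w in H | twins G z w] \subset s.
  apply/subsetP => w; rewrite inE => /andP[wH zw].
  by have := no w; rewrite /= wH zw /= => /negbFE.
move=> /subset_leq_card le.
by have := leq_trans (full zH) (leq_trans le (card_size s)); lia.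
Qed.

(* If the predecessor of [v] on a shortest path is not kept, swap it with a kept
   twin other than [u] and [v]. *)
Lemma kept_bwd r u v : u \in H -> v \in H -> xdist u v = r.+2 ->
  exists2 z, z \in H & xdist u z = r.+1 /\ G z v.
Proof.
move=> uH vH /xdist_bwd[z uz zv]; case: (boolP (z \in H)) => zH; first by exists z.
have [z' [zH' tw]] := @fresh_twin z [:: u; v] zH isT.
rewrite !inE negb_or => /andP[zu zv']; exists z' => //.
have fixed x : x \in H -> z' != x -> tperm z z' x = x.
  by move=> xH zx; rewrite tpermD //; apply/eqP => E; rewrite E xH in zH.
split; first by rewrite -{1}(fixed u uH zu) -[in X in xdist _ X](tpermL z z') xdist_swap.
by have := swap_hom tw zv; rewrite tpermL fixed.
Qed.

(** Walking back from [v] with [kept_bwd] meets a kept vertex at each value from [xdist u v] down to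
    1, and these vertices are distinct. This bounds the number of rounds. *)
Lemma kept_xdist_le u v : u \in H -> v \in H -> xdist u v <= #|H|.
Proof.
move=> uH vH; case E : (xdist u v) => [//|r].
suff : r.+1 <= #|[set w in H | 0 < xdist u w <= r.+1]|.
  by move=> /leq_trans; apply; apply: subset_leq_card; apply/subsetP => w; rewrite inE => /andP[].
elim: r v vH E => [|r IH] v vH uv.
  by apply/card_gt0P; exists v; rewrite inE vH uv.
have [z zH [uz _]] := kept_bwd uH vH uv.
apply: leq_ltn_trans (IH z zH uz) _; apply: proper_card; apply/properP; split.
  by apply/subsetP => w; rewrite !inE => /andP[-> /=]; lia.
by exists v; rewrite !inE vH uv /= ?ltnn.
Qed.

(* One vertex of [s] is swapped with a kept twin outside [s] at a time. *)
Lemma kept_move (s : seq V) : size s <= 4 ->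
  exists f : V -> V, {in s, forall x, f x \in H} /\
    forall x y, xdist (f x) (f y) = xdist x y.
Proof.
have [m] := ubnP (count [predC H] s); elim: m s => // m IH s cm ss.
case: (boolP (has [predC H] s)) => [/hasP[z zs zH]|]; last first.
  rewrite -all_predC => /allP sH; exists id; split=> // x /sH /=.
  by rewrite negbK.
rewrite inE /= in zH.
have [|z' [zH' tw]] := @fresh_twin z (rem z s) zH; first by rewrite size_rem //; case: (size s) ss.
have z'z : z' != z by apply/eqP => E; rewrite -E zH' in zH.
move=> z'rem; have z's : z' \notin s.
  by apply: contra z'rem => z's; rewrite (perm_mem (perm_to_rem zs)) inE (negPf z'z) in z's.
have [||f [fH ft]] := IH (map (tperm z z') s); rewrite ?size_map //.
  rewrite -ltnS; apply: leq_trans cm; rewrite ltnS count_map.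
  apply: (count_lt (x := z)) => //=; last by rewrite tpermL negbK.
  move=> y ys /=; case: tpermP => [->|yz'|//]; first by rewrite zH'.
  by rewrite -yz' ys in z's.
exists (f \o tperm z z'); split=> [x xs|x y] /=; first by apply: fH; exact: map_f.
by rewrite ft xdist_swap.
Qed.

End Kept.

Lemma card_kept (H : {set V}) :
  (forall c, #|[set w in H | twins G c w]| <= 4) -> #|H| <= 4 * nd G.
Proof.
move=> le4; have eqv := twins_equiv G.
have /and3P[/eqP cov triv _] := equivalence_partitionP eqv.
set P := equivalence_partition _ _ in cov triv *.
rewrite -sum1_card (partition_big (pblock P) (mem P)) /=; last first.
  by move=> x _; apply: pblock_mem; rewrite cov inE.
rewrite /nd -/P mulnC -sum_nat_const; apply: leq_sum => C _.
rewrite sum1_card; case: (pickP [pred x in H | pblock P x == C]) => [c /andP[_ /eqP cC]|no].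
  apply: leq_trans (le4 c); apply: subset_leq_card; apply/subsetP => x.
  move=> /andP[xH /eqP xC]; rewrite inE xH /=.
  have : x \in pblock P c by rewrite cC -xC mem_pblock cov inE.
  by rewrite pblock_equivalence_partition ?inE.
by rewrite eq_card0 // => x; have := no x; rewrite unfold_in /=.
Qed.

(* Sending (u, v) to the edge {u, v} together with the order of its endpoints
   is injective on arcs. *)
Lemma sum_degrees : \sum_(u : V) #|[set v | G u v]| <= (nb_edges G).*2.
Proof.
rewrite (eq_bigr (fun u => \sum_(v | G u v) 1)); last first.
  by move=> u _; rewrite -sum1_card; apply: eq_bigl => v; rewrite inE.
rewrite pair_big_dep /= sum1_card.
pose f (p : V * V) : {set V} * bool := ([set p.1; p.2], enum_rank p.1 < enum_rank p.2).
have -> : (nb_edges G).*2 = #|setX (edge_set G) [set: bool]|.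
  by rewrite cardsX cardsT card_bool muln2.
have inj : {in [pred p : V * V | G p.1 p.2] &, injective f}.
  move=> [u v] [u' v'] _ _ [E].
  have : u \in [set u'; v'] by rewrite -E set21.
  have : v \in [set u'; v'] by rewrite -E set22.
  have : u' \in [set u; v] by rewrite E set21.
  have : v' \in [set u; v] by rewrite E set22.
  rewrite !inE.
  have [uu'|uu'] := eqVneq u u'.
    subst u' => /orP[]/eqP v'E _ /orP[]/eqP vE _ _; congruence.
  rewrite /= => _ /eqP u'E _ /eqP uE.
  rewrite uE u'E; case: (ltngtP (enum_rank v') (enum_rank v)) => // /val_inj/enum_rank_inj E'.
  by rewrite uE u'E E' eqxx in uu'.
rewrite -(card_in_image inj); apply: subset_leq_card; apply/subsetP => _ /imageP[[u v] uv ->].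
rewrite !inE andbT; apply/existsP; exists u; apply/existsP; exists v.
by move: uv; rewrite inE => -> /=.
Qed.

End Graph.

(** * Indices of kept vertices, and hyperbolicity as half an integer *)

Import Order.TTheory GRing.Theory Num.Theory.

(** The abundance of kept twins enters through [lev_le] and [lev_bwd]; the other clauses hold for
    any list without repetition. *)
Lemma index_levels (V : finType) (G : sgraph V) (v0 : V) (ks : seq V) :
  uniq ks ->
  (forall z, z \notin [set x in ks] ->
     4 <= #|[set w in [set x in ks] | twins G z w]|) ->
  levels (size ks) (fun k j => G (nth v0 ks k) (nth v0 ks j))
    (fun i j => xdist G (nth v0 ks i) (nth v0 ks j)).
Proof.
move=> uks full; have cardH : #|[set x in ks]| = size ks.
  by rewrite cardsE; apply/card_uniqP.
have inH i : i < size ks -> nth v0 ks i \in [set x in ks].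
  by move=> iK; rewrite inE mem_nth.
split.
- by move=> i j iK jK; rewrite -cardH; apply: (kept_xdist_le full); exact: inH.
- by move=> i iK; exact: xdist_refl.
- by move=> i j iK jK /xdist_one /eqP; rewrite nth_uniq // => /eqP.
- by move=> r i j k iK jK kK; exact: xdist_fwd.
- move=> r i j iK jK /(kept_bwd full (inH i iK) (inH j jK))[z zH [uz zv]].
  rewrite inE in zH; exists (index z ks); first by rewrite index_mem.
  by rewrite nth_index.
Qed.

Section Hyperbolicity.

Variables (V : finType) (G : sgraph V).

Definition vgap u v x y :=
  (xdist G u v + xdist G x y) - maxn (xdist G u x + xdist G v y) (xdist G u y + xdist G v x).

Definition vlinked u v x y := [&& 0 < xdist G u v, 0 < xdist G u x & 0 < xdist G u y].

Local Open Scope ring_scope.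

(** All six pairs are connected, so each of the three sums is shifted by exactly two and the shifts
    cancel. Truncated subtraction turns negative differences into 0: upper bounds survive, equality
    only for a positive value. *)
Lemma vgap_rat u v x y (M : nat) : vlinked u v x y ->
  let q : rat := ((dist G u v + dist G x y)%:R
    - Num.max (dist G u x + dist G v y)%:R (dist G u y + dist G v x)%:R) / 2 in
  ((vgap u v x y <= M)%N -> q <= M%:R / 2) /\
  ((0 < M)%N -> vgap u v x y = M -> q = M%:R / 2).
Proof.
have csym := sym_connect_sym (edge_sym G).
rewrite /vlinked !xdist_gt0 => /and3P[uv ux uy].
have xy : connect G x y by rewrite (connect_trans _ uy) // csym.
have vy : connect G v y by rewrite (connect_trans _ uy) // csym.
have vx : connect G v x by rewrite (connect_trans _ ux) // csym.
rewrite /vgap /xdist uv ux uy xy vy vx.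
move: (dist G u v) (dist G x y) (dist G u x) (dist G v y) (dist G u y) (dist G v x).
move=> a b c d e f; rewrite -natr_max maxEnat /=; split=> [le|M0 E].
  by rewrite ler_pM2r // lerBlDr -natrD ler_nat; lia.
by congr (_ / _); apply/eqP; rewrite subr_eq -natrD eqr_nat; lia.
Qed.

(** A truncated gap of 0 may hide a negative difference; for [M = 0] the value is therefore supplied
    by the neutral element of the maximum. *)
Lemma hyperbolicityE (M : nat) :
  (forall u v x y, vlinked u v x y -> (vgap u v x y <= M)%N) ->
  M = 0%N \/ (exists u v x y, vlinked u v x y /\ vgap u v x y = M) ->
  hyperbolicity G = M%:R / 2.
Proof.
move=> ub att.
have M0 : (0 : rat) <= M%:R / 2 by rewrite divr_ge0.
have linkE u v x y : [&& connect G u v, connect G u x & connect G u y] = vlinked u v x y.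
  by rewrite /vlinked !xdist_gt0.
apply/le_anti/andP; split.
  apply: bigmax_le => // u _; apply: bigmax_le => // v _.
  apply: bigmax_le => // x _; apply: bigmax_le => // y; rewrite linkE => lk.
  by apply: (vgap_rat M lk).1; exact: ub.
case: (posnP M) => [->|Mpos].
  by rewrite mul0r; apply: bigmax_ge_id.
case: att => [E|[u [v [x [y [lk E]]]]]]; first by rewrite E in Mpos.
rewrite -((vgap_rat M lk).2 Mpos E).
apply: le_trans (le_bigmax _ _ u); apply: le_trans (le_bigmax _ _ v).
apply: le_trans (le_bigmax _ _ x); apply: le_trans (le_bigmax_cond _ _ (j := y) _) => //.
by rewrite linkE.
Qed.

End Hyperbolicity.

Lemma card_set_count (T : finType) (s : seq T) (P : pred T) : uniq s ->
  #|[set w in [set x in s] | P w]| = count P s.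
Proof.
move=> us; rewrite -size_filter -(card_uniqP (filter_uniq P us)).
by apply: eq_card => w; rewrite !inE mem_filter andbC.
Qed.

Lemma nth_flatten_arcs (f : nat -> seq nat) m v i : v < m -> i < size (f v) ->
  nth 0 (flatten [seq f u | u <- iota 0 m]) (arcs f v + i) = nth 0 (f v) i.
Proof.
move=> vm isz; rewrite -(subnKC (ltnW vm)) iotaD map_cat flatten_cat nth_cat.
have -> : size (flatten [seq f u | u <- iota 0 v]) = arcs f v.
  rewrite size_flatten /shape -map_comp sumnE big_map /arcs /index_iota subn0.
  by [].
rewrite ltnNge leq_addr addKn add0n; have -> : m - v = (m - v.+1).+1 by lia.
by rewrite /= nth_cat isz.
Qed.

(** * The encoded input and the meaning of the labels *)

Section Input.

Variables (n : nat) (G : sgraph 'I_n) (adj : 'I_n -> seq 'I_n).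
Hypothesis adjP : adjacency_lists G adj.

Definition nbs (v : nat) : seq nat :=
  if insub v is Some i then map val (adj i) else [::].

Lemma nbs_val (i : 'I_n) : nbs i = map val (adj i).
Proof. by rewrite /nbs valK. Qed.

Lemma mem_nbs (x z : 'I_n) : (val x \in nbs z) = G z x.
Proof. by rewrite nbs_val (mem_map val_inj) (adjP z).2. Qed.

Lemma nbs_lists : neighbour_lists n nbs.
Proof.
split=> v; rewrite /nbs; case: insubP => [i _ iv|//].
- by rewrite (map_inj_uniq val_inj) (adjP i).1.
- by move=> x /mapP[j _ ->]; exact: (ltn_ord j).
- by rewrite -iv (mem_map val_inj) (adjP i).2 edge_irr.
Qed.

Lemma size_nbs (i : 'I_n) : size (nbs i) = #|[set v | G i v]|.
Proof.
have [u ui] := adjP i; rewrite nbs_val size_map -(card_uniqP u).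
by apply: eq_card => v; rewrite ui inE.
Qed.

Lemma arcs_nbs : arcs nbs n <= (nb_edges G).*2.
Proof.
apply: leq_trans (sum_degrees G); rewrite /arcs big_mkord.
by apply: leq_sum => i _; rewrite size_nbs.
Qed.

Lemma input_lists : graph_input n nbs (input adj).
Proof.
split=> // [v vn|v i vn isz].
  rewrite [LHS](nth_mkseq _ _ (n := n.+1)) // /arcs (big_nat_widen _ _ _ _ _ vn) big_mkord.
  by apply: eq_bigr => u _; rewrite nbs_val size_map.
rewrite -(nth_flatten_arcs vn isz) /= map_flatten -map_comp.
congr (nth 0 (flatten _) _); rewrite -val_enum_ord -map_comp.
by apply: eq_map => u /=; rewrite nbs_val.
Qed.

Lemma input_scanned : 0 < n -> scanned n nbs (input adj) 0 [::].
Proof.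
move=> n0; split=> //; last by move=> x z _ _; rewrite /= andbF.
exists (fun=> [::]); split=> //=.
- by move=> t u; rewrite !inE !leqn0 => /eqP-> /eqP->.
- by move=> t; lia.
Qed.

Lemma historyP x y :
  history nbs n n x = history nbs n n y <->
  forall z : 'I_n, member nbs n z x = member nbs n z y.
Proof.
split=> [E z|E]; last first.
  apply: eq_in_filter => z; rewrite mem_rev mem_iota add0n /= => zn.
  exact: (E (Ordinal zn)).
have := congr1 (fun s => val z \in s) E.
by rewrite !mem_filter mem_rev mem_iota /= ltn_ord !andbT.
Qed.

Lemma label_history s x y : scanned n nbs s n [::] -> x < n.*2 -> y < n.*2 ->
  arrs s 2 x = arrs s 2 y <-> history nbs n n x = history nbs n n y.
Proof.
move=> [[S tr] _ _] xn yn; have E := trie_inj_lab tr xn yn.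
by split=> /eqP; [rewrite E|rewrite -[_ == _]E] => /eqP.
Qed.

Lemma open_label s (x y : 'I_n) : scanned n nbs s n [::] ->
  arrs s 2 x = arrs s 2 y <-> forall z, G x z = G y z.
Proof.
move=> sc; have xn := ltn_ord x; have yn := ltn_ord y.
have lt2 m : m < n -> m < n.*2 by lia.
rewrite (label_history sc (lt2 _ xn) (lt2 _ yn)) historyP.
by split=> E z; have := E z; rewrite /member xn yn !mem_nbs !(edge_sym G z).
Qed.

Lemma closed_label s (x y : 'I_n) : scanned n nbs s n [::] ->
  arrs s 2 (n + x) = arrs s 2 (n + y) <->
  forall z, G x z || (z == x) = G y z || (z == y).
Proof.
move=> sc; have xn := ltn_ord x; have yn := ltn_ord y.
have lt2 m : m < n -> n + m < n.*2 by lia.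
rewrite (label_history sc (lt2 _ xn) (lt2 _ yn)) historyP.
have mE (z w : 'I_n) : member nbs n z (n + w) = G w z || (z == w).
  by rewrite /member ltnNge leq_addr addKn mem_nbs edge_sym eq_sym.
by split=> E z; have := E z; rewrite !mE.
Qed.

(** The size bound uses [twins_uniform]: a twin class shares a label whose counter is capped. The
    abundance of kept twins uses the converse, [twins_open] and [twins_closed]. *)
Lemma selection_spec s ks : scanned n nbs s n [::] ->
  selected (arrs s 2) (fun x => arrs s 2 (n + x)) n (map val ks) ->
  [/\ uniq ks, size ks <= 4 * nd G &
      forall z, z \notin [set x in ks] ->
        4 <= #|[set w in [set x in ks] | twins G z w]|].
Proof.
move=> sc [uks _ a4 b4 full]; rewrite (map_inj_uniq val_inj) in uks.
split=> // [|z].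
  rewrite -(card_uniqP uks) -cardsE; apply: card_kept => c.
  have sub (P : pred nat) : (forall w, twins G c w -> P (val w)) ->
      #|[set w in [set x in ks] | twins G c w]| <= count P (map val ks).
    move=> cP; rewrite count_map -card_set_count //; apply: subset_leq_card.
    by apply/subsetP => w; rewrite !inE => /andP[-> /cP].
  have [op|cl] := twins_uniform G c.
    apply: leq_trans (sub _ _) (a4 (arrs s 2 c)) => w tw; apply/eqP.
    by rewrite open_label //; exact: op.
  apply: leq_trans (sub _ _) (b4 (arrs s 2 (n + c))) => w tw; apply/eqP.
  by rewrite closed_label //; exact: cl.
rewrite inE => zks.
have sup (P : pred nat) : (forall w : 'I_n, P (val w) -> twins G z w) ->
    count P (map val ks) <= #|[set w in [set x in ks] | twins G z w]|.
  move=> Pz; rewrite count_map -card_set_count //; apply: subset_leq_card.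
  by apply/subsetP => w; rewrite !inE => /andP[-> /Pz].
have zks' : val z \notin map val ks by rewrite (mem_map val_inj).
case: (full z (ltn_ord z) zks') => /leq_trans; apply; apply: sup => w /eqP.
  by rewrite open_label // => E; apply: twins_open => y.
by rewrite closed_label // => E; apply: twins_closed => y.
Qed.

End Input.

(** * The whole program and its running time *)

Definition program : cmd :=
  Seq scan (Seq select (Seq distances (Seq maximize
    (Seq (Assign 0 (Reg 9)) (Assign 1 (Const 2)))))).

(** Each loop adds 18 to the coefficient: 10 per iteration and 8 once. Four nested loops around a
    body of cost at most [a] thus give [a + 72]. *)
Lemma loop_cost_le K M c a j : K <= M -> 0 < M -> c <= a * M ^ j ->
  loop_cost K c <= (a + 18) * M ^ j.+1.
Proof.
move=> KM M0 ca; have Mj : 0 < M ^ j by rewrite expn_gt0 M0.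
rewrite /loop_cost expnS mulnCA.
apply: (@leq_trans (M * (c + 10) + 8 * M)).
  by apply: leq_add; [rewrite leq_mul2r KM orbT|rewrite leq_pmulr].
by rewrite [8 * M]mulnC -mulnDr leq_mul2l mulnDl; apply/orP; right; lia.
Qed.

Lemma program_ok W n (G : sgraph 'I_n) (adj : 'I_n -> seq 'I_n) :
  0 < n -> adjacency_lists G adj ->
  8 * (n + nb_edges G).+1 ^ 2 <= W ->
  ok W program (input adj)
    (512 * ((4 * nd G) ^ 4 + n + nb_edges G))
    (fun s => outputs s (hyperbolicity G)).
Proof.
move=> n0 adjP bW; set m := nb_edges G in bW *.
have arcs2 := arcs_nbs adjP; rewrite -/m in arcs2.
(* Addresses in the trie table dictate the word bound: with [N = n + m + 1] the first factor is at
   most [4 * N], as [arcs] is at most [2 * m], and the second at most [2 * N]. *)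
have W1 : ((arcs (nbs adj) n).*2 + n + 4) * n.+2 <= W.
  apply: leq_trans bW; rewrite -mulnn mulnA.
  apply: (@leq_trans ((4 * (n + m).+1) * (2 * (n + m).+1))); last by lia.
  by apply: leq_mul; lia.
have W2 : n * n <= W by nia.
have W3 : n * 4 + 2 <= W by nia.
have W4 : n.*2 + 4 <= W by nia.
have nbl := nbs_lists adjP; have gi := input_lists adj.
have sc0 := input_scanned adj n0.
have scanP := ok_frame (scan_ok nbl gi W1 sc0).
suff [s' [t [ex lt Qs]]] : ok W program (input adj)
  (100 * arcs (nbs adj) n + 110 * n + 8 + (100 * n + 8 +
    (160 * (4 * nd G) ^ 4 + (200 * (4 * nd G) ^ 4 + 4))))
  (fun s => outputs s (hyperbolicity G)).
  exists s', t; split=> //; apply: leq_trans lt _.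
  (* The total is at most [360 * X + 210 * n + 200 * m + 20], and [0 < n] absorbs the constant. *)
  by move: ((4 * nd G) ^ 4) => X; lia.
apply: ok_seq; apply: ok_conseq scanP (leqnn _) _ => s1 [sc1 [fr1 fa1]].
have [r10 r18 r19] : [/\ regs s1 0 = n, regs s1 8 = 0 & regs s1 9 = 0].
  by split; rewrite fr1.
have z1 a i : a \in [:: 5; 6; 8] -> arrs s1 a i = 0.
  by rewrite !inE => /or3P[]/eqP->; rewrite fa1.
have A1 : forall x z, x < n -> z < n -> arrs s1 4 (x * n + z) = (x \in nbs adj z).
  by case: sc1 => _ _ A x z xn zn; rewrite A // zn andbF orbF.
have selP := ok_frame (@select_ok W n (arrs s1 2) (fun x => arrs s1 2 (n + x)) s1
  r10 W4 (fun _ _ => erefl) (fun _ _ => erefl) r18 _).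
apply: ok_seq; apply: ok_conseq (selP _) (leqnn _) _.
  by move=> a i ain; apply: z1; move: ain; rewrite !inE => /orP[]->; rewrite ?orbT.
move=> s2 [[ksn [sel r28 L2 _ _]] [fr2 fa2]].
have [ks ksE] : exists ks : seq 'I_n, ksn = map val ks.
  exists (pmap insub ksn); rewrite pmap_filter; last by move=> x; rewrite insubK.
  apply/esym/all_filterP/allP => x /(sel_lt sel) xn /=.
  by rewrite insubT.
rewrite ksE in sel r28 L2 => {ksE ksn}; rewrite size_map in r28 L2.
have [uks Knd full] := selection_spec adjP sc1 sel.
set K := size ks in r28 L2 Knd.
have Kn : K <= n by have := selected_size sel; rewrite size_map.
pose v0 := Ordinal n0.
have lev := index_levels v0 uks full; rewrite -/K in lev.
have L2' i : i < K -> arrs s2 7 i = nth v0 ks i.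
  by move=> iK; rewrite L2 // (nth_map v0).
have en : env n K (fun k j => G (nth v0 ks k) (nth v0 ks j)) s2.
  split=> //; first by rewrite fr2.
  move=> k j kK jK; rewrite !L2' // !ltn_ord; do 2!split=> //.
  by rewrite fa2 // A1 // (mem_nbs adjP) edge_sym.
have D2 x : arrs s2 8 x = 0 by rewrite fa2 // z1.
have nW2 : n + 2 <= W by lia.
(* Required by [loop_cost_le]. If nothing were kept, [v0] would be a rejected vertex without kept
   twins. *)
have K0 : 0 < 4 * nd G.
  case: (posnP (4 * nd G)) => [nd0|//]; rewrite nd0 leqn0 in Knd.
  have /full : v0 \notin [set x in ks] by rewrite inE (size0nil (eqP Knd)).
  by rewrite (size0nil (eqP Knd)) card_set_count.
have distP := ok_frame (distances_ok lev W2 nW2 en D2).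
have dist_cost : loop_cost K 10 +
    loop_cost K (loop_cost K (loop_cost K (loop_cost K 60))) <= 160 * (4 * nd G) ^ 4.
  have c1 : loop_cost K 10 <= 28 * (4 * nd G) ^ 1.
    by apply: (@loop_cost_le _ _ _ 10).
  have c4 : loop_cost K (loop_cost K (loop_cost K (loop_cost K 60)))
      <= 132 * (4 * nd G) ^ 4.
    apply: (@loop_cost_le _ _ _ 114) => //; apply: (@loop_cost_le _ _ _ 96) => //.
    by apply: (@loop_cost_le _ _ _ 78) => //; apply: (@loop_cost_le _ _ _ 60).
  rewrite -[160]/(28 + 132) mulnDl; apply: leq_add c4; apply: leq_trans c1 _.
  by rewrite leq_mul2l leq_pexp2l ?orbT.
apply: ok_seq; apply: ok_conseq distP dist_cost _.
move=> s3 [[r30 [r38 D3]] [fr3 fa3]].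
have best3 : best n K (fun i j => xdist G (nth v0 ks i) (nth v0 ks j)) s3.
  by split=> //; left; rewrite fr3 // fr2.
have max_cost : loop_cost K (loop_cost K (loop_cost K (loop_cost K (cost improve))))
    <= 200 * (4 * nd G) ^ 4.
  apply: (@loop_cost_le _ _ _ 182) => //; apply: (@loop_cost_le _ _ _ 164) => //.
  by apply: (@loop_cost_le _ _ _ 146) => //; apply: (@loop_cost_le _ _ _ 128).
apply: ok_seq; apply: ok_conseq (maximize_ok (lev_le lev) W2 W3 Kn best3) max_cost _.
move=> s4 [[r40 r48 D4 att] ub]; apply: ok_wp; rewrite /=; safety.
split=> //=; apply: hyperbolicityE.
  move=> u v x y lk.
  (* An arbitrary quadruple is moved among the kept vertices with its mutual distances unchanged, so
     its gap was compared by the loops. *)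
  have [f [fks ftgt]] := kept_move full (s := [:: u; v; x; y]) isT.
  have idx z : z \in [:: u; v; x; y] ->
      index (f z) ks < K /\ nth v0 ks (index (f z) ks) = f z.
    by move=> /fks; rewrite inE => fz; rewrite index_mem nth_index.
  have [|iK iE] := idx u; first by rewrite !inE eqxx ?orbT.
  have [|jK jE] := idx v; first by rewrite !inE eqxx ?orbT.
  have [|kK kE] := idx x; first by rewrite !inE eqxx ?orbT.
  have [|lK lE] := idx y; first by rewrite !inE eqxx ?orbT.
  have := ub _ _ _ _ iK jK kK lK.
  by rewrite /beaten /linked /gap iE jE kE lE !ftgt => /(_ lk).
case: att => [|[i [j [k [l [_ lk ->]]]]]]; [by left|right].
by exists (nth v0 ks i), (nth v0 ks j), (nth v0 ks k), (nth v0 ks l).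
Qed.

Theorem theorem12 :
  exists (p : cmd) (C w : nat),
  forall (n : nat) (G : sgraph 'I_n) (adj : 'I_n -> seq 'I_n),
    0 < n -> adjacency_lists G adj ->
    exists (s : state) (t : nat),
      exec ((n + nb_edges G).+1 ^ w) p (input adj) s t /\
      t <= C * (nd G ^ 4 + n + nb_edges G) /\
      outputs s (hyperbolicity G).
Proof.
(* The factor [4 ^ 4] comes from expanding [(4 * nd G) ^ 4]. The exponent 5 absorbs the constant in
   [8 * N ^ 2], where [N = n + m + 1] is at least 2 and so [8 <= N ^ 3]. *)
exists program, (512 * 4 ^ 4), 5 => n G adj n0 adjP.
have [|s [t [ex lt out]]] := program_ok (W := (n + nb_edges G).+1 ^ 5) n0 adjP.
  have b2 : 2 ^ 3 <= (n + nb_edges G).+1 ^ 3 by rewrite leq_exp2r //; lia.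
  by rewrite (expnD _ 3 2) leq_mul2r b2 orbT.
exists s, t; split=> //; split=> //; apply: leq_trans lt _.
rewrite -mulnA leq_mul2l !mulnDr expnMn; apply/orP; right.
by apply: leq_add; [apply: leq_add|]; rewrite ?leq_pmull.
Qed.
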